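(* Let $A\in\mathbb{R}^{N\times N}$ be symmetric negative definite and $B\in\mathbb{R}^{N\times N}$. Let $(a_j,b_j,c_j)_{0\le j\le s}$ be the real coefficients of an $s$-step implicit-explicit linear multistep scheme ($s\ge 1$, $b_s=0$, $a_s\neq 0$, $c_s\neq 0$), with unconditional stability region $\mathcal{D}\subseteq\mathbb{C}$, and for $p\in\mathbb{R}$ let $W_p\subseteq\mathbb{C}$ be the set associated with the splitting $(A,B)$. If there exists $p\in\mathbb{R}$ such that $W_p\subseteq\mathcal{D}$, then the scheme $$\frac1k\sum_{j=0}^s a_j u_{n+j}=\sum_{j=0}^s\big(c_jAu_{n+j}+b_jBu_{n+j}\big)$$ is unconditionally stable.
   Context: Notation: $\langle x,y\rangle=\overline{x}^Ty$ and $\|x\|^2=\langle x,x\rangle$ for $x,y\in\mathbb{C}^N$. $A$ and $B$ are not assumed to commute. $k>0$ is the time step. For the scheme to define $u_{n+s}$ from the previous values, the matrix $a_sI-kc_sA$ is taken to be invertible for every $k>0$. Scheme. With forcing $f_n\in\mathbb{R}^N$, the scheme is $\frac1k\sum_{j=0}^s a_ju_{n+j}=\sum_{j=0}^s(c_jAu_{n+j}+b_jBu_{n+j}+b_jf_{n+j})$ with initial vectors $u_0,\dots,u_{s-1}$; stability concerns the case $f=0$. Unconditional stability. The scheme is unconditionally stable if, when $f=0$, there is a constant $C$ such that $\|u_n\|\le C\max_{0\le j\le s-1}\|u_j\|$ for all $n\ge s$, all $k>0$, and all $u_0,\dots,u_{s-1}\in\mathbb{R}^N$. Here $C$ may depend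 on $A$, $B$ and $(a_j,b_j,c_j)$, but not on $k$, $n$ or the initial vectors. Region $\mathcal{D}$. Let $a(z)=\sum_{j=0}^sa_jz^j$, $b(z)=\sum_{j=0}^{s-1}b_jz^j$, $c(z)=\sum_{j=0}^sc_jz^j$. For $y<0$, $\mathcal{D}_y$ is the set of $\mu\in\mathbb{C}$ such that every solution $\zeta\in\mathbb{C}$ of $a(\zeta)=y\,c(\zeta)-y\mu\,b(\zeta)$ satisfies $|\zeta|<1$. $\mathcal{D}_{-\infty}$ is the set of $\mu\in\mathbb{C}$ such that every root $\zeta$ of $c(\zeta)-\mu b(\zeta)$ satisfies $|\zeta|<1$. Then $\mathcal{D}=\mathcal{D}_{-\infty}\cap\bigcap_{y<0}\mathcal{D}_y$. Set $W_p$. For $p\in\mathbb{R}$, $W_p=\{\langle v,(-A)^{p-1}Bv\rangle : v\in\mathbb{C}^N,\ \langle v,(-A)^pv\rangle=1\}$, where real powers of the symmetric positive definite matrix $-A$ are defined by the spectral theorem.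
   Formalization: Zero-stability is added (all roots of a(z) lie in the closed unit disc, those on the circle simple); without it the claim fails, e.g. N=1, A=-1, B=0, a=(z-1)^2, b=0, c=z^2, and for N≥1 it is necessary for unconditional stability. *)

(* Defs.v *)
From HB Require Import structures.
From mathcomp Require Import all_boot all_order all_algebra.
From mathcomp Require Import complex.
From mathcomp Require Import classical_sets reals exp.

Set Implicit Arguments.
Unset Strict Implicit.
Unset Printing Implicit Defensive.

Import Order.TTheory GRing.Theory Num.Theory.

Local Open Scope ring_scope.
Local Open Scope sesquilinear_scope.

Section LinearAlgebra.
Variables (R : realType) (N : nat).

Definition cplxmx (M : 'M[R]_N) : 'M[R[i]]_N := map_mx (real_complex R) M.

Definition cdot (x y : 'cV[R[i]]_N) : R[i] := (x^t* *m y) 0 0.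

Definition enorm (x : 'cV[R]_N) : R := Num.sqrt ((x^T *m x) 0 0).

Definition neg_definite (M : 'M[R]_N) : Prop :=
  forall x : 'cV[R]_N, x != 0 -> (x^T *m M *m x) 0 0 < 0.

(* Functional calculus in a unitary diagonalisation
   M = invmx P *m diag_mx d *m P, where d is real and positive when M is
   Hermitian positive definite; the definition is meant for such M only. *)
Definition mxpowR (M : 'M[R[i]]_N) (p : R) : 'M[R[i]]_N :=
  invmx (spectralmx M)
    *m diag_mx (map_mx (fun z => real_complex R (complex.Re z `^ p))
                       (spectral_diag M))
    *m spectralmx M.

Definition Wset (A B : 'M[R]_N) (p : R) : set R[i] :=
  [set cdot v (mxpowR (cplxmx (- A)) (p - 1) *m cplxmx B *m v)
  | v in [set v | cdot v (mxpowR (cplxmx (- A)) p *m v) = 1]]%classic.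

End LinearAlgebra.

Section Scheme.
Variables (R : realType) (s : nat).
Implicit Types a b c : 'I_s.+1 -> R.

(* For b the sum may run up to j = s because b_s = 0. *)
Definition coefpoly a : {poly R[i]} :=
  \sum_(j < s.+1) real_complex R (a j) *: 'X^j.

Definition Dregion_at a b c (y : R) : set R[i] :=
  [set mu | forall z : R[i],
      (coefpoly a).[z] = real_complex R y * (coefpoly c).[z]
                         - real_complex R y * mu * (coefpoly b).[z] ->
      `|z| < 1]%classic.

Definition Dregion_minfty b c : set R[i] :=
  [set mu | forall z : R[i],
      root (coefpoly c - mu *: coefpoly b) z -> `|z| < 1]%classic.

Definition Dregion a b c : set R[i] :=
  (Dregion_minfty b c
   `&` \bigcap_(y in [set y : R | (y < 0)%R]) Dregion_at a b c y)%classic.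

(* Dahlquist's root condition. It is not implied by W_p <= D: for
   a = ('X - 1)^2, b = 0, c = 'X^2, A = -1, B = 0 one has W_p = {0} <= D, but
   u_0 = 0, u_1 = 1 gives max_n |u_n| -> +oo as k -> 0. *)
Definition zero_stable a : Prop :=
  forall z : R[i], root (coefpoly a) z ->
    `|z| <= 1 /\ (`|z| = 1 -> ~~ root (coefpoly a)^`() z).

Definition scheme_solution N (A B : 'M[R]_N) a b c
    (k : R) (f u : nat -> 'cV[R]_N) : Prop :=
  forall n : nat,
    k^-1 *: (\sum_(j < s.+1) a j *: u (n + j)%N)
    = \sum_(j < s.+1) (c j *: (A *m u (n + j)%N) + b j *: (B *m u (n + j)%N)
                       + b j *: f (n + j)%N).

Definition unconditionally_stable N (A B : 'M[R]_N) a b c : Prop :=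
  exists C : R, forall (k : R) (u : nat -> 'cV[R]_N),
    0 < k -> scheme_solution A B a b c k (fun=> 0) u ->
    forall n : nat, (s <= n)%N ->
      enorm (u n) <= C * \big[Num.max/0]_(j < s) enorm (u j).

End Scheme.

(* Main.v *)
From HB Require Import structures.
Require Import Defs.
From mathcomp Require Import all_boot all_order all_algebra.
From mathcomp Require Import complex ring zify.
From mathcomp Require Import classical_sets boolp reals exp topology normedtype.

(** The step size enters through [x = 1 / (1 + k)], which turns the two
    degenerate regimes [k -> 0] and [k -> +oo] into the end points of the
    compact interval [[0, 1]].  Multiplied by [k / (1 + k)], the scheme reads
    [\sum_j P_j u_(n+j) = 0] with
    [P_j = x a_j - (1 - x) (c_j A + b_j B)], and what has to be bounded,
    uniformly in [0 < x < 1], are the powers of the companion matrix of this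
    recurrence.

    Pairing the symbol [\sum_j z^j P_j] with a vector [v] through the weight
    [(-A)^(p-1)] gives the value at [z] of the scalar polynomial
    [x alpha a + (1 - x) (beta c - gamma b)], where [alpha] and [beta] are
    positive and [gamma / beta] lies in [W_p] ([cdot_symbol]).  The inclusion
    [W_p <= D] says that for [x < 1] the roots of this polynomial are in the
    open unit disc; for [x = 1] they are those of [a], for which the root
    condition holds.  As [(x, v)] ranges over a compact set, the modulus of
    the polynomial at [z] is at least a constant times [|z| - 1] for
    [1 <= |z| <= 2]: the bound is linear in [|z| - 1] because two roots can
    never approach the same point outside the open disc
    ([uniform_root_bound], [rangepoly_bound]).

    A lower bound for a quadratic form bounds the inverse of the symbol, hence
    the resolvent of the companion matrix, by a constant over [|z| - 1]
    ([symbol_bound], [companion_resolvent]).  By the Kreiss matrix theorem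
    such a resolvent bound controls all powers, with a constant that depends
    on the dimension only ([kreiss_linear]).

    The Kreiss theorem is proved by induction on the dimension of a lower
    triangular matrix with blocks [l], [x], [M].  The corner of its [n]-th
    power is [\sum_(j < n) l^j M^(n-1-j) x].  For [z] the reflection of [l] in
    the unit circle, write [x = (z - M) y]: the resolvent bound at this single
    point bounds [y], the part [(l - M) y] makes the sum telescope, and the
    remaining [(z - l) y] gains the factor [z - l], of the order of [1 - |l|],
    which compensates the geometric sum of the [l^j] ([block_power],
    [reflected_point]). *)

Set Implicit Arguments.
Unset Strict Implicit.
Unset Printing Implicit Defensive.

Import Order.TTheory GRing.Theory Num.Theory numFieldNormedType.Exports.

Local Open Scope ring_scope.

(** * The entrywise norm of matrices *)

Section Norm1.
Variable F : numDomainType.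

(** The entrywise l1 norm is submultiplicative across rectangular sizes and
    additive over blocks, so that block estimates need no comparison of norms. *)
Definition norm1 m n (M : 'M[F]_(m, n)) : F := \sum_i \sum_j `|M i j|.

Lemma norm1_ge0 m n (M : 'M[F]_(m, n)) : 0 <= norm1 M.
Proof. by apply: sumr_ge0 => i _; apply: sumr_ge0. Qed.

Lemma norm1_entry m n (M : 'M[F]_(m, n)) i j : `|M i j| <= norm1 M.
Proof.
rewrite /norm1 (bigD1 i) //= (bigD1 j) //= -addrA lerDl.
by rewrite addr_ge0 ?sumr_ge0 // => i' _; apply: sumr_ge0.
Qed.

Lemma norm1_0 m n : norm1 (0 : 'M[F]_(m, n)) = 0.
Proof. by rewrite /norm1 big1 // => i _; rewrite big1 // => j _; rewrite mxE normr0. Qed.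

Lemma norm1_eq0 m n (M : 'M[F]_(m, n)) : norm1 M <= 0 -> M = 0.
Proof.
move=> M0; apply/matrixP=> i j; rewrite mxE; apply/eqP.
by rewrite -normr_le0 (le_trans (norm1_entry _ _ _)).
Qed.

Lemma norm1D m n (M P : 'M[F]_(m, n)) : norm1 (M + P) <= norm1 M + norm1 P.
Proof.
rewrite /norm1 -big_split; apply: ler_sum => i _ /=; rewrite -big_split.
by apply: ler_sum => j _ /=; rewrite mxE ler_normD.
Qed.

Lemma norm1N m n (M : 'M[F]_(m, n)) : norm1 (- M) = norm1 M.
Proof. by apply: eq_bigr => i _; apply: eq_bigr => j _; rewrite mxE normrN. Qed.

Lemma norm1Z m n (a : F) (M : 'M[F]_(m, n)) : norm1 (a *: M) = `|a| * norm1 M.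
Proof.
rewrite /norm1 mulr_sumr; apply: eq_bigr => i _; rewrite mulr_sumr.
by apply: eq_bigr => j _; rewrite mxE normrM.
Qed.

Lemma norm1_sum m n (I : Type) (r : seq I) (P : pred I) (M : I -> 'M[F]_(m, n)) :
  norm1 (\sum_(i <- r | P i) M i) <= \sum_(i <- r | P i) norm1 (M i).
Proof.
elim/big_ind2: _ => [|u x w y ux wy|//]; first by rewrite norm1_0.
exact: le_trans (norm1D _ _) (lerD ux wy).
Qed.

Lemma norm1M m n p (M : 'M[F]_(m, n)) (P : 'M[F]_(n, p)) :
  norm1 (M *m P) <= norm1 M * norm1 P.
Proof.
rewrite /norm1 mulr_suml; apply: ler_sum => i _.
have -> : (\sum_j `|M i j|) * (\sum_k \sum_l `|P k l|)
    = \sum_j \sum_l \sum_k `|M i k| * `|P j l|.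
  rewrite mulr_sumr; apply: eq_bigr => j _; rewrite mulr_sumr.
  by apply: eq_bigr => l _; rewrite mulr_suml.
rewrite exchange_big /=; apply: ler_sum => l _.
rewrite mxE (le_trans (ler_norm_sum _ _ _)) //; apply: ler_sum => j _.
by rewrite normrM (bigD1 j) //= lerDl sumr_ge0 // => k _; rewrite mulr_ge0.
Qed.

Lemma norm1_11 (M : 'M[F]_1) : norm1 M = `|M 0 0|.
Proof. by rewrite /norm1 !big_ord1. Qed.

Lemma norm1_scalar (a : F) : norm1 (a%:M : 'M[F]_1) = `|a|.
Proof. by rewrite norm1_11 mxE eqxx mulr1n. Qed.

Lemma norm1_row_mx m n1 n2 (M : 'M[F]_(m, n1)) (P : 'M[F]_(m, n2)) :
  norm1 (row_mx M P) = norm1 M + norm1 P.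
Proof.
rewrite /norm1 -big_split; apply: eq_bigr => i _ /=; rewrite big_split_ord /=.
by congr (_ + _); apply: eq_bigr => j _; rewrite ?row_mxEl ?row_mxEr.
Qed.

Lemma norm1_col_mx m1 m2 n (M : 'M[F]_(m1, n)) (P : 'M[F]_(m2, n)) :
  norm1 (col_mx M P) = norm1 M + norm1 P.
Proof.
rewrite /norm1 big_split_ord /=.
by congr (_ + _); apply: eq_bigr => i _; apply: eq_bigr => j _; rewrite ?col_mxEu ?col_mxEd.
Qed.

Lemma norm1_tr m n (M : 'M[F]_(m, n)) : norm1 M^T = norm1 M.
Proof. by rewrite /norm1 exchange_big; apply: eq_bigr => i _; apply: eq_bigr => j _; rewrite mxE. Qed.

Lemma norm1_mxvec m n (M : 'M[F]_(m, n)) : norm1 (mxvec M) = norm1 M.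
Proof.
rewrite /norm1 big_ord1 pair_bigA /=.
rewrite (reindex _ (curry_mxvec_bij m n)) /=.
by apply: eq_bigr => -[i j] _; rewrite mxvecE.
Qed.

(** The corner [t_n] of the power solves [t_(n+1) = M t_n + l^n x].  Writing
    the forcing [x] as [(z - l) y + (l - M) y] makes the second part
    telescope, and the first part carries the factor [z - l], which is small
    when [z] is close to [l]. *)
Lemma block_power d (l z : F) (M : 'M[F]_d) (x y : 'cV[F]_d) n :
    x = z *: y - M *m y ->
  (block_mx l%:M 0 x M : 'M_(1 + d)) ^+ n =
  block_mx (l ^+ n)%:M 0
    (l ^+ n *: y - M ^+ n *m y
     + (z - l) *: \sum_(j < n) l ^+ j *: (M ^+ (n.-1 - j) *m y)) (M ^+ n).
Proof.
move=> xE; elim: n => [|n IHn].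
  by rewrite !expr0 big_ord0 scaler0 addr0 scale1r mul1mx subrr -scalar_mx_block.
rewrite exprS IHn -[LHS]/(mulmx _ _) mulmx_block !mul0mx !mulmx0 !addr0 !add0r.
rewrite -scalar_mxM -exprS; congr block_mx; last by rewrite [in RHS]exprS.
rewrite mul_mx_scalar !mulmxDr mulmxN -!scalemxAr mulmx_sumr.
rewrite big_ord_recr /= subnn expr0 mul1mx mulmxA.
rewrite (_ : M *m M ^+ n = M ^+ n.+1); last by rewrite [in RHS]exprS.
under eq_bigr => j _ do rewrite -scalemxAr mulmxA.
rewrite (_ : \sum_(j < n) _ = \sum_(j < n) l ^+ j *: (M ^+ (n - j) *m y)); last first.
  apply: eq_bigr => j _; congr (_ *: (_ *m _)).
  by rewrite -[LHS]/(M * _) -exprS; congr (_ ^+ _); have := ltn_ord j; lia.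
rewrite xE; set s := \sum_(_ < _) _; set w := M *m y; set t := M ^+ _ *m _.
rewrite exprS; apply/colP => i; rewrite !mxE; ring.
Qed.

End Norm1.

(** * The Kreiss matrix theorem *)

Section Kreiss.
Variable C : numClosedFieldType.

(** A lower bound, rather than a bound on an inverse, passes directly to the
    diagonal blocks of a triangular matrix.  The annulus [1 < |z| <= 2] is
    large enough to contain the points of [reflected_point], and small enough
    for powers of [z] of bounded degree to be bounded. *)
Definition resolvent_bound d (K : C) (M : 'M[C]_d) : Prop :=
  forall (z : C) (v : 'rV[C]_d), 1 < `|z| <= 2 ->
    (`|z| - 1) * norm1 v <= K * norm1 (z *: v - v *m M).

Definition spectrum_in_disc d (M : 'M[C]_d) : Prop :=
  forall (z : C) (v : 'rV[C]_d), 1 <= `|z| -> v *m M = z *: v -> v = 0.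

(** The first coordinate is chosen to solve its own equation; a vector for
    [M] is thus lifted to the block matrix with the same residual, and the
    hypotheses on the block matrix descend to [M]. *)
Lemma block_lift d (l z : C) (M : 'M[C]_d) (x : 'cV[C]_d) (v : 'rV[C]_d) :
  z != l -> let u := row_mx ((z - l)^-1 *: (v *m x)) v in
  z *: u - u *m (block_mx l%:M 0 x M : 'M_(1 + d)) = row_mx 0 (z *: v - v *m M).
Proof.
move=> zl u; rewrite /u mul_row_block mulmx0 add0r scale_row_mx opp_row_mx.
rewrite add_row_mx; congr row_mx; rewrite mul_mx_scalar opprD addrA -scalerBl.
by rewrite scalerA mulfV ?scale1r ?subrr // subr_eq0.
Qed.

(** The reflection [1 / l^*] of [l] in the unit circle is at distance
    [(1 - |l|^2) / |l|] from [l].  It leaves the annulus when [|l| < 1 / 2],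
    where [1 - |l|] is bounded below and [z = 2] serves as well. *)
Lemma reflected_point (l : C) : `|l| < 1 ->
  exists z : C, [/\ 1 < `|z| <= 2, `|z - l| <= 6 * (1 - `|l|)
                  & `|z - l| <= 3 * (`|z| - 1)].
Proof.
move=> l1; have lr : `|l| \is Num.real by rewrite normr_real.
have hr : (2^-1 : C) \is Num.real by rewrite ger0_real ?invr_ge0.
have [lh|lh] := real_leP hr lr; last first.
  have d3 : `|2 - l| <= 3.
    rewrite (le_trans (ler_normB _ _)) // normr_nat.
    by rewrite (natrD C 2 1) lerD2l ltW.
  exists 2; rewrite normr_nat ltr1n lexx; split=> //; apply: le_trans d3 _.
    have {1}-> : 3 = 6 * (1 - 2^-1) :> C by field.
    by rewrite ler_wpM2l // lerD2l lerN2 ltW.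
  by rewrite (_ : 2 - 1 = 1) ?mulr1 // -[2]/(1 + 1) addrK.
have l0 : 0 < `|l| by apply: lt_le_trans lh; rewrite invr_gt0 ltr0n.
exists (l^* )^-1.
have lc0 : l^* != 0 by rewrite conjC_eq0 -normr_gt0.
have -> : (l^* )^-1 - l = (l^* )^-1 * (1 - `|l| ^+ 2).
  by rewrite normCK mulrBr mulr1 [l * _]mulrC mulrA mulVf ?mul1r.
rewrite normrM normfV norm_conjC (ger0_norm (_ : 0 <= 1 - _)); last first.
  by rewrite subr_ge0 expr_le1 // ltW.
have e : `|l|^-1 * (1 - `|l| ^+ 2) = (`|l|^-1 - 1) * (1 + `|l|).
  by field; rewrite gt_eqF.
have li2 : `|l|^-1 <= 2 by rewrite -[2]invrK lef_pV2 ?posrE ?invr_gt0.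
have li1 : 1 < `|l|^-1 by rewrite invf_gt1.
split; first by rewrite li1 li2.
  have -> : 1 - `|l| ^+ 2 = (1 - `|l|) * (1 + `|l|) by ring.
  rewrite [6 * _]mulrC mulrCA ler_wpM2l ?subr_ge0 ?(ltW l1) //.
  have -> : 6 = 2 * 3 :> C by ring.
  apply: ler_pM; rewrite ?invr_ge0 ?addr_ge0 //.
  by rewrite (natrD C 1 2) lerD2l (le_trans (ltW l1)) ?ler1n.
rewrite e [3 * _]mulrC ler_wpM2l ?subr_ge0 ?(ltW li1) //.
by rewrite (natrD C 1 2) lerD2l (le_trans (ltW l1)) ?ler1n.
Qed.

Lemma geometric_le (l : C) n : `|l| < 1 -> (\sum_(j < n) `|l| ^+ j) * (1 - `|l|) <= 1.
Proof.
move=> l1; rewrite mulrC -[1 - _]opprB mulNr -subrX1 opprB gerBl.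
exact: exprn_ge0.
Qed.

Fixpoint kreiss_const (K : C) d : C :=
  if d is d'.+1 then
    let c := kreiss_const K d' in 1 + (3 * K * d'%:R * (1 + c + 6 * c) + c)
  else 0.

Lemma kreiss_const_ge0 K d : 0 <= K -> 0 <= kreiss_const K d.
Proof.
move=> K0; elim: d => [|d IHd] //=.
by rewrite ?(addr_ge0, mulr_ge0, ler0n, ler01).
Qed.

(** Applied to lifted vectors, the resolvent bound controls the resolvent of
    [M] and also the functional [v |-> v x / (z - l)].  Tested on the rows of
    [(z - M)^-1] at the reflected point [z], it bounds the entries of
    [y = (z - M)^-1 x] by [3 K], uniformly in [l]: this is the estimate that
    [block_power] turns into a bound on the powers. *)
Lemma kreiss_trig (K : C) d (M : 'M[C]_d) : 0 <= K -> is_trig_mx M ->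
    resolvent_bound K M -> spectrum_in_disc M ->
  forall n, norm1 (M ^+ n) <= kreiss_const K d.
Proof.
move=> K0; move: d M; apply: trigsqmx_ind => [|d l0 x M _ IHM] resM specM n.
  by rewrite /norm1 big_ord0.
have [l lE] : exists l : C, l0 = l%:M by exists (l0 0 0); rewrite -mx11_scalar.
rewrite {}lE {l0} in resM specM *.
have l1 : `|l| < 1.
  have lr : `|l| \is Num.real by rewrite normr_real.
  rewrite real_ltNge ?real1 //; apply/negP => /(specM l (row_mx 1%:M 0)).
  rewrite mul_row_block !mul0mx mul1mx mulmx0 !addr0 scale_row_mx scaler0 scalemx1.
  move=> /(_ erefl)/(congr1 lsubmx); rewrite row_mxKl => /matrixP/(_ 0 0)/eqP.
  by rewrite !mxE eqxx oner_eq0.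
have zNl z : 1 <= `|z| -> z != l.
  by move=> z1; apply: contraTneq l1 => <-; rewrite real_ltNge ?real1 ?z1 // normr_real.
have lift_bound z (v : 'rV_d) : 1 < `|z| <= 2 ->
    (`|z| - 1) * (norm1 (v *m x) / `|z - l| + norm1 v)
      <= K * norm1 (z *: v - v *m M).
  move=> z12; have /zNl zl : 1 <= `|z| by case/andP: z12 => /ltW.
  have := resM z (row_mx ((z - l)^-1 *: (v *m x)) v) z12.
  rewrite block_lift // !norm1_row_mx norm1Z norm1_0 add0r normfV.
  by rewrite [_^-1 * _]mulrC.
have resM' : resolvent_bound K M.
  move=> z v z12; apply: le_trans (lift_bound z v z12).
  have [z1 _] := andP z12.
  by rewrite ler_wpM2l ?subr_ge0 ?(ltW z1) // lerDr divr_ge0 ?norm1_ge0.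
have specM' : spectrum_in_disc M.
  move=> z v z1 vM; have := specM z (row_mx ((z - l)^-1 *: (v *m x)) v) z1.
  move=> H; suff /H /(congr1 rsubmx) : row_mx ((z - l)^-1 *: (v *m x)) v *m
      (block_mx l%:M 0 x M : 'M_(1 + d)) = z *: row_mx ((z - l)^-1 *: (v *m x)) v.
    by rewrite row_mxKr linear0.
  by apply/esym/eqP; rewrite -subr_eq0 block_lift ?zNl // vM subrr row_mx0.
have {IHM} powM := IHM resM' specM'.
have [z [z12 zl6 zl3]] := reflected_point l1.
have [z1 z2] := andP z12.
have zM : z%:M - M \in unitmx.
  rewrite -row_free_unit -kermx_eq0; apply/eqP/row_matrixP => i; rewrite row0.
  apply: (specM' z _ (ltW z1)).
  have /eqP := mulmx_ker (z%:M - M) => /eqP/(congr1 (row i)).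
  by rewrite row_mul mulmxBr mul_mx_scalar row0 => /eqP; rewrite subr_eq0 => /eqP.
pose y := invmx (z%:M - M) *m x.
have xE : x = z *: y - M *m y by rewrite -mul_scalar_mx -mulmxBl mulKVmx.
(* The entry [y i] is the pairing of [x] with the [i]-th row of [(z - M)^-1]. *)
have y_le : norm1 y <= 3 * K * d%:R.
  have -> : 3 * K * d%:R = \sum_(i < d) 3 * K.
    by rewrite sumr_const card_ord mulr_natr.
  apply: ler_sum => i _; rewrite big_ord1.
  pose v : 'rV[C]_d := delta_mx 0 i *m invmx (z%:M - M).
  have vE : z *: v - v *m M = delta_mx 0 i.
    by rewrite -mul_mx_scalar -mulmxBr mulmxKV.
  have := lift_bound z v z12; rewrite vE.
  have -> : norm1 (delta_mx 0 i : 'rV[C]_d) = 1.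
    rewrite /norm1 big_ord1 (bigD1 i) //= mxE !eqxx normr1 big1 ?addr0 //.
    by move=> j ji; rewrite mxE (negPf ji) andbF normr0.
  have -> : v *m x = delta_mx 0 i *m y by rewrite mulmxA.
  rewrite -rowE norm1_11 mxE mulr1 => yi.
  have z1' : 0 < `|z| - 1 by rewrite subr_gt0.
  have zl0 : 0 < `|z - l| by rewrite normr_gt0 subr_eq0 zNl ?ltW.
  have {}yi : (`|z| - 1) * (`|y i 0| / `|z - l|) <= K.
    by apply: le_trans yi; rewrite ler_wpM2l ?(ltW z1') // lerDl norm1_ge0.
  rewrite -(ler_pM2l z1') (@le_trans _ _ (K * `|z - l|)) //.
    by rewrite -ler_pdivrMr // -mulrA.
  by rewrite [leRHS](_ : _ = K * (3 * (`|z| - 1))) ?ler_wpM2l //; ring.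
rewrite (block_power l n xE) /block_mx norm1_col_mx !norm1_row_mx norm1_0 addr0.
rewrite norm1_scalar normrX /= lerD ?exprn_ile1 ?(ltW l1) // lerD ?powM //.
set c := kreiss_const K d in powM *.
have c0 : 0 <= c by exact: kreiss_const_ge0.
have ny := norm1_ge0 y.
have Mny k : norm1 (M ^+ k *m y) <= c * norm1 y.
  by rewrite (le_trans (norm1M _ _)) // ler_wpM2r.
apply: (@le_trans _ _ (norm1 y * (1 + c + 6 * c))); last first.
  by rewrite ler_wpM2r // !addr_ge0 // mulr_ge0.
rewrite mulrDr (le_trans (norm1D _ _)) // lerD //.
  rewrite mulrDr mulr1 (le_trans (norm1D _ _)) // norm1N norm1Z lerD //.
    by rewrite ler_piMl // normrX exprn_ile1 // ltW.
  by rewrite [leRHS]mulrC.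
(* The factor [|z - l| <= 6 (1 - |l|)] absorbs the geometric sum of the [|l|^j]. *)
rewrite norm1Z.
have sum_le : norm1 (\sum_(j < n) l ^+ j *: (M ^+ (n.-1 - j) *m y))
    <= (\sum_(j < n) `|l| ^+ j) * (c * norm1 y).
  rewrite (le_trans (norm1_sum _ _ _)) // mulr_suml; apply: ler_sum => j _.
  by rewrite norm1Z normrX ler_wpM2l // exprn_ge0.
apply: le_trans (ler_wpM2l (normr_ge0 _) sum_le) _.
apply: (@le_trans _ _ (6 * (1 - `|l|) * ((\sum_(j < n) `|l| ^+ j) * (c * norm1 y)))).
  by rewrite ler_wpM2r // mulr_ge0 ?mulr_ge0 // sumr_ge0 // => j _; rewrite exprn_ge0.
rewrite [leLHS](_ : _ = 6 * c * norm1 y * ((\sum_(j < n) `|l| ^+ j) * (1 - `|l|))); last by ring.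
by rewrite [leRHS]mulrC ler_piMr ?geometric_le // !mulr_ge0.
Qed.

End Kreiss.

Section KreissGeneral.
Local Open Scope sesquilinear_scope.
Variable C : numClosedFieldType.

Lemma norm1_unitary d (P : 'M[C]_d) : P \is unitarymx -> norm1 P <= (d * d)%:R.
Proof.
move=> /unitarymxP PP; rewrite natrM /norm1.
have -> : d%:R * d%:R = \sum_(i < d) \sum_(j < d) (1 : C).
  by rewrite !sumr_const !card_ord mulr_natr.
apply: ler_sum => i _; apply: ler_sum => j _.
rewrite -(expr_le1 (n := 2)) //.
have : (P *m P ^t*) i i = 1 by rewrite PP mxE eqxx.
rewrite mxE (bigD1 j) //= !mxE -normCK => <-.
by rewrite lerDl sumr_ge0 // => k _; rewrite !mxE -normCK exprn_ge0.
Qed.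

(** The unitary triangularisation of Schur reduces to the triangular case;
    conjugating by a unitary matrix costs a factor [d ^ 2] on each side. *)
Theorem kreiss_matrix d (K : C) : 0 <= K -> exists2 c : C, 0 <= c &
  forall M : 'M[C]_d, resolvent_bound K M -> spectrum_in_disc M ->
  forall n, norm1 (M ^+ n) <= c.
Proof.
move=> K0; pose e : C := (d * d)%:R; pose c := kreiss_const (e * K * e) d.
have e0 : 0 <= e by exact: ler0n.
have K'0 : 0 <= e * K * e by rewrite !mulr_ge0.
exists (e * c * e); first by rewrite !mulr_ge0 // kreiss_const_ge0.
move=> M resM specM n; case: (posnP d) => [d0|d_gt0].
  rewrite /norm1 big1 ?mulr_ge0 ?kreiss_const_ge0 // => i.
  by have := ltn_ord i; rewrite [X in (_ < X)%N]d0.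
have [P Pu] := Schur M d_gt0; rewrite /similar_to /= conjymx // => Ttrig.
set T := P *m M *m P^t* in Ttrig.
have PV : P *m P^t* = 1%:M by exact/unitarymxP.
have VP : P^t* *m P = 1%:M by rewrite -(invmx_unitary Pu) mulVmx ?unitarymx_unit.
have eP : norm1 P <= e := norm1_unitary Pu.
have eV : norm1 (P^t*) <= e by rewrite norm1_unitary ?trmxC_unitary.
have MT : M ^+ n = P^t* *m T ^+ n *m P.
  elim: n => [|n IHn]; first by rewrite !expr0 mulmx1 VP.
  rewrite exprSr IHn [in RHS]exprSr -[in LHS]/(mulmx _ _) -[in RHS]/(mulmx (T ^+ n) _).
  by rewrite /T !mulmxA -[_ *m P^t* *m P]mulmxA VP mulmx1.
rewrite {}MT (le_trans (norm1M _ _)) // ler_pM ?norm1_ge0 //.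
rewrite (le_trans (norm1M _ _)) // ler_pM ?norm1_ge0 //.
apply: kreiss_trig => // z v z12.
  have [z1 _] := andP z12.
  have vE : v = v *m P *m P^t* by rewrite -mulmxA PV mulmx1.
  have zv : z *: (v *m P) - v *m P *m M = (z *: v - v *m T) *m P.
    by rewrite mulmxBl scalemxAl /T !mulmxA -[_ *m P^t* *m P]mulmxA VP mulmx1.
  rewrite {1}vE (@le_trans _ _ ((`|z| - 1) * (norm1 (v *m P) * e))) //.
    rewrite ler_wpM2l ?subr_ge0 ?(ltW z1) // (le_trans (norm1M _ _)) //.
    by rewrite ler_wpM2l ?norm1_ge0.
  rewrite mulrA [leRHS](_ : _ = K * (norm1 (z *: v - v *m T) * e) * e); last by ring.
  rewrite ler_wpM2r // (le_trans (resM z (v *m P) z12)) // zv ler_wpM2l //.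
  by rewrite (le_trans (norm1M _ _)) // ler_wpM2l ?norm1_ge0.
move=> vT; have : v *m P = 0.
  apply: (specM z _ z12); rewrite scalemxAl -vT /T !mulmxA.
  by rewrite -[_ *m P^t* *m P]mulmxA VP mulmx1.
by move/(congr1 (fun u => u *m P^t*)); rewrite -mulmxA PV mulmx1 mul0mx.
Qed.

(** The constant is chosen before [f], which is what makes the stability of a
    family of schemes uniform. *)
Theorem kreiss_linear m n (K : C) : 0 <= K -> exists2 c : C, 0 <= c &
  forall f : {linear 'M[C]_(m, n) -> 'M[C]_(m, n)},
    (forall (z : C) X, 1 < `|z| <= 2 ->
       (`|z| - 1) * norm1 X <= K * norm1 (z *: X - f X)) ->
    (forall (z : C) X, 1 <= `|z| -> f X = z *: X -> X = 0) ->
  forall k X, norm1 (iter k f X) <= c * norm1 X.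
Proof.
move=> /(@kreiss_matrix (m * n)) [c c0 Hc]; exists c => // f res spec k X.
have iterE : mxvec (iter k f X) = mxvec X *m lin_mx f ^+ k.
  elim: k => [|k IHk]; first by rewrite expr0 mulmx1.
  by rewrite iterS -(mul_vec_lin f) IHk exprSr -mulmxA.
rewrite -norm1_mxvec iterE (le_trans (norm1M _ _)) // norm1_mxvec mulrC.
rewrite ler_wpM2r ?norm1_ge0 // Hc // => z v.
  move=> z12; have := res z (vec_mx v) z12.
  rewrite -[norm1 (vec_mx v)]norm1_mxvec -[norm1 (_ - _)]norm1_mxvec vec_mxK.
  by rewrite linearB linearZ /= -(mul_vec_lin f) vec_mxK.
move=> z1 vE; rewrite -[v]vec_mxK (spec z (vec_mx v)) ?linear0 //.
by apply: (can_inj mxvecK); rewrite -(mul_vec_lin f) vec_mxK vE linearZ /= vec_mxK.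
Qed.

End KreissGeneral.

(** * Companion operators of matrix recurrences *)

Section Companion.
Variables (F : fieldType) (N s : nat) (P : 'I_s.+1 -> 'M[F]_N).

Definition recurrence (w : nat -> 'cV[F]_N) n := \sum_(j < s.+1) P j *m w (n + j)%N.

Definition next (U : 'M[F]_(N, s)) : 'cV[F]_N :=
  - (invmx (P ord_max) *m \sum_(j < s) P (widen_ord (leqnSn s) j) *m col j U).

(** The columns of [U] followed by the vector that the recurrence forces
    next; shifting a window amounts to reading [extend] one place further. *)
Definition extend U (j : nat) : 'cV[F]_N :=
  if insub j is Some k then col (k : 'I_s) U else next U.

(** The block companion matrix, as an operator on the [N x s] matrices whose
    columns are [s] consecutive terms. *)
Definition companion (U : 'M[F]_(N, s)) : 'M[F]_(N, s) :=
  \matrix_(i, j) extend U j.+1 i 0.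

Definition window (w : nat -> 'cV[F]_N) n : 'M[F]_(N, s) := \matrix_(i, j) w (n + j)%N i 0.

Lemma companion_is_linear : linear companion.
Proof.
move=> t U V; apply/matrixP => i j; rewrite !mxE /extend.
case: insubP => [k _ _|_]; first by rewrite !mxE.
rewrite /next.
have -> : \sum_(j < s) P (widen_ord (leqnSn s) j) *m col j (t *: U + V) =
   t *: (\sum_(j < s) P (widen_ord (leqnSn s) j) *m col j U)
   + \sum_(j < s) P (widen_ord (leqnSn s) j) *m col j V.
  rewrite scaler_sumr -big_split; apply: eq_bigr => l _ /=.
  by rewrite linearD linearZ /= mulmxDr scalemxAr.
by rewrite mulmxDr -scalemxAr !mxE mulrN opprD.
Qed.

HB.instance Definition _ :=
  GRing.isLinear.Build F 'M[F]_(N, s) 'M[F]_(N, s) *:%R companion companion_is_linear.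

Lemma col_window w n (j : 'I_s) : col j (window w n) = w (n + j)%N.
Proof. by apply/colP => i; rewrite !mxE. Qed.

(** The recursion [w_(l+1) = z w_l - g_l], unrolled, where [g] is the defect
    of [w] from being geometric of ratio [z]. *)
Lemma defect_expand (w : nat -> 'cV[F]_N) (z : F) j :
  w j = z ^+ j *: w 0%N - \sum_(l < j) z ^+ (j.-1 - l) *: (z *: w l - w l.+1).
Proof.
elim: j => [|j IHj]; first by rewrite big_ord0 subr0 scale1r.
rewrite big_ord_recr /= subnn scale1r opprD.
have -> : \sum_(l < j) z ^+ (j - l) *: (z *: w l - w l.+1) =
    z *: \sum_(l < j) z ^+ (j.-1 - l) *: (z *: w l - w l.+1).
  rewrite scaler_sumr; apply: eq_bigr => l _; rewrite scalerA -exprS.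
  by congr (_ ^+ _ *: _); have := ltn_ord l; lia.
by rewrite addrA exprS -scalerA -scalerBr -IHj opprB addrCA subrr addr0.
Qed.

Definition symbol (z : F) (v : 'cV[F]_N) := \sum_(j < s.+1) z ^+ j *: (P j *m v).

(** The geometric part of [w] contributes the symbol to the recurrence, the
    defect contributes the rest: solving for the resolvent of the companion
    operator comes down to inverting the symbol. *)
Lemma symbol_defect w (z : F) : recurrence w 0 = 0 ->
  symbol z (w 0%N) =
  \sum_(j < s.+1) P j *m (\sum_(l < j) z ^+ (j.-1 - l) *: (z *: w l - w l.+1)).
Proof.
move=> rec; apply/eqP; rewrite -subr_eq0 -sumrB -[X in _ == X]rec; apply/eqP.
apply: eq_bigr => j _.
by rewrite add0n [in RHS](defect_expand w z j) mulmxBr -scalemxAr.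
Qed.

Hypothesis unitP : P ord_max \in unitmx.

Lemma recurrence_last w n : recurrence w n =
  \sum_(j < s) P (widen_ord (leqnSn s) j) *m w (n + j)%N + P ord_max *m w (n + s)%N.
Proof. by rewrite /recurrence big_ord_recr. Qed.

Lemma extend_recurrence U : recurrence (extend U) 0 = 0.
Proof.
rewrite recurrence_last {2}/extend insubN ?ltnn // /next mulmxN mulKVmx //.
apply/eqP; rewrite subr_eq0; apply/eqP; apply: eq_bigr => j _.
by rewrite /extend add0n valK.
Qed.

Lemma extend_window w n j : recurrence w n = 0 -> (j <= s)%N ->
  extend (window w n) j = w (n + j)%N.
Proof.
move=> rec js; rewrite /extend; case: insubP => [k _ <-|]; first exact: col_window.
rewrite -leqNgt => sj; have -> : j = s by apply/eqP; rewrite eqn_leq js.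
move: rec; rewrite recurrence_last => /eqP; rewrite addrC addr_eq0 => /eqP rec.
rewrite /next -mulmxN -[RHS](mulKmx unitP) rec; congr (_ *m - _).
by apply: eq_bigr => l _; rewrite col_window.
Qed.

Lemma companion_window w n : recurrence w n = 0 ->
  companion (window w n) = window w n.+1.
Proof.
by move=> rec; apply/matrixP => i j; rewrite !mxE extend_window // addnS addSn.
Qed.

Lemma col_extend U (j : 'I_s) : col j U = extend U j.
Proof. by rewrite /extend valK. Qed.

Lemma col_companion U (j : 'I_s) : col j (companion U) = extend U j.+1.
Proof. by apply/colP => i; rewrite !mxE. Qed.

End Companion.

Section CompanionBound.
Variables (C : numClosedFieldType) (N s : nat).

Lemma norm1_col (U : 'M[C]_(N, s)) : norm1 U = \sum_j norm1 (col j U).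
Proof.
rewrite -norm1_tr; apply: eq_bigr => j _; apply: eq_bigr => i _.
by rewrite big_ord1 !mxE.
Qed.

(** The defect of [extend U] is the residual [z U - companion U], column by
    column, so [symbol_defect] bounds the first column of [U] by the residual
    and [defect_expand] bounds the others.  Each power [z^j] with [j <= s]
    costs at most [2^s]. *)
Lemma companion_resolvent (P : 'I_s.+1 -> 'M[C]_N) (m k z : C) U :
    P ord_max \in unitmx -> 1 < `|z| <= 2 ->
    \sum_j norm1 (P j) <= m -> 0 <= k ->
    (forall v, (`|z| - 1) * norm1 v <= k * norm1 (symbol P z v)) ->
  (`|z| - 1) * norm1 U <=
    s%:R * (2 ^+ s * (k * (m * 2 ^+ s) + 1)) * norm1 (z *: U - companion P U).
Proof.
move=> uP /andP[z1 z2] Pm k0 Hz.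
set G := z *: U - companion P U; pose w := extend P U; pose g l := z *: w l - w l.+1.
have zm : 0 <= `|z| - 1 by rewrite subr_ge0 ltW.
have zm1 : `|z| - 1 <= 1 by rewrite lerBlDr.
have colG (j : 'I_s) : col j G = g j.
  by rewrite /G linearB linearZ /= col_companion (col_extend P).
have zpow i : (i <= s)%N -> `|z| ^+ i <= 2 ^+ s.
  move=> i_s; apply: le_trans (_ : 2 ^+ i <= _).
    by rewrite lerXn2r ?nnegrE // (le_trans _ z2) // normr_ge0.
  by rewrite ler_weXn2l ?ler1n.
have tail j : (j <= s)%N ->
    norm1 (\sum_(l < j) z ^+ (j.-1 - l) *: g l) <= 2 ^+ s * norm1 G.
  move=> js; rewrite norm1_col mulr_sumr (le_trans (norm1_sum _ _ _)) //.
  rewrite [leRHS](eq_bigr (fun l : 'I_s => 2 ^+ s * norm1 (g l))); last first.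
    by move=> l _; rewrite colG.
  rewrite -(big_mkord xpredT (fun l => norm1 (z ^+ (j.-1 - l) *: g l))).
  rewrite -(big_mkord xpredT (fun l => 2 ^+ s * norm1 (g l))).
  rewrite [leRHS](big_cat_nat (leq0n j) js) /= ler_wpDr //.
    by apply: sumr_ge0 => l _; rewrite mulr_ge0 ?norm1_ge0 ?exprn_ge0.
  apply: ler_sum => l _; rewrite norm1Z normrX ler_wpM2r ?norm1_ge0 // zpow //.
  by rewrite (leq_trans (leq_subr _ _)) // (leq_trans (leq_pred _)).
have w0_le : (`|z| - 1) * norm1 (w 0%N) <= k * (m * 2 ^+ s) * norm1 G.
  apply: le_trans (Hz _) _; rewrite -!mulrA ler_wpM2l //.
  rewrite (symbol_defect z (extend_recurrence uP U)) (le_trans (norm1_sum _ _ _)) //.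
  apply: le_trans (_ : (\sum_j norm1 (P j)) * (2 ^+ s * norm1 G) <= _); last first.
    by rewrite ler_wpM2r // mulr_ge0 ?norm1_ge0 ?exprn_ge0.
  rewrite mulr_suml; apply: ler_sum => j _; rewrite (le_trans (norm1M _ _)) //.
  by rewrite ler_wpM2l ?norm1_ge0 // tail // -ltnS.
rewrite norm1_col mulr_sumr -!mulrA mulr_natl -[X in _ *+ X]card_ord -sumr_const.
apply: ler_sum => j _; rewrite (col_extend P) -/w (defect_expand w z j).
have js := ltnW (ltn_ord j).
apply: le_trans (ler_wpM2l zm (norm1D _ _)) _; rewrite norm1N norm1Z normrX mulrDr.
rewrite [(_ + 1) * _]mulrDl mul1r mulrDr lerD //.
  rewrite mulrCA; apply: ler_pM; rewrite ?exprn_ge0 ?mulr_ge0 ?norm1_ge0 ?zpow //.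
by rewrite (le_trans _ (tail j js)) // ler_piMl ?norm1_ge0.
Qed.

Lemma companion_spectrum (P : 'I_s.+1 -> 'M[C]_N) (z : C) U :
    P ord_max \in unitmx ->
    (forall v, symbol P z v = 0 -> v = 0) ->
  companion P U = z *: U -> U = 0.
Proof.
move=> uP inj UE; pose w := extend P U.
have g0 l : (l < s)%N -> z *: w l - w l.+1 = 0.
  move=> ls; have /(congr1 (col (Ordinal ls))) := UE.
  rewrite linearZ /= col_companion (col_extend P) => e.
  by apply/eqP; rewrite subr_eq0; apply/eqP/esym.
have tail j : (j <= s)%N -> \sum_(l < j) z ^+ (j.-1 - l) *: (z *: w l - w l.+1) = 0.
  by move=> js; rewrite big1 // => l _; rewrite g0 ?scaler0 // (leq_trans (ltn_ord l)).
have w0 : w 0%N = 0.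
  apply: inj; rewrite (symbol_defect z (extend_recurrence uP U)) big1 // => j _.
  by rewrite tail ?mulmx0 // -ltnS.
apply/matrixP => i j; have := col_extend P U j; rewrite -/w (defect_expand w z j).
by rewrite w0 scaler0 tail ?subr0 1?ltnW // => /colP/(_ i); rewrite !mxE.
Qed.

End CompanionBound.

(** * A root bound that is uniform over a compact family *)

Section Continuity.
Local Open Scope classical_set_scope.
Variables (C : numFieldType) (T : topologicalType).
Implicit Types f g : T -> C.

Lemma continuous_fun_add f g : continuous f -> continuous g -> continuous (fun x => f x + g x).
Proof. by move=> cf cg x; apply: continuousD; [exact: cf|exact: cg]. Qed.

Lemma continuous_fun_opp f : continuous f -> continuous (fun x => - f x).
Proof. by move=> cf x; apply: continuousN; exact: cf. Qed.

Lemma continuous_fun_mul f g : continuous f -> continuous g -> continuous (fun x => f x * g x).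
Proof. by move=> cf cg x; apply: continuousM; [exact: cf|exact: cg]. Qed.

Lemma continuous_fun_norm f : continuous f -> continuous (fun x => `|f x| : C).
Proof. by move=> cf x; apply: cvg_norm; exact: cf. Qed.

Lemma continuous_fun_sum (I : Type) (r : seq I) (P : pred I) (F : I -> T -> C) :
  (forall i, continuous (F i)) -> continuous (fun x => \sum_(i <- r | P i) F i x).
Proof.
move=> cF; apply: (continuous_big (op := +%R)) => // x.
exact: add_continuous.
Qed.

Lemma continuous_fun_prod (I : Type) (r : seq I) (P : pred I) (F : I -> T -> C) :
  (forall i, continuous (F i)) -> continuous (fun x => \prod_(i <- r | P i) F i x).
Proof.
move=> cF; apply: (@continuous_big C I *%R 1 P _ T r F) => // x.
exact: mul_continuous.
Qed.

Lemma closed_fun_eq f g : continuous f -> continuous g -> closed [set x | f x = g x].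
Proof.
move=> cf cg; have -> : [set x | f x = g x] = (fun x => f x - g x) @^-1` [set 0].
  by apply/seteqP; split=> x /= => [->|/eqP]; rewrite ?subrr // subr_eq0 => /eqP.
apply: preimage_closed.
  by move=> x _; apply: continuous_fun_add => //; exact: continuous_fun_opp.
apply: accessible_closed_set1; apply: hausdorff_accessible; exact: norm_hausdorff.
Qed.

(** The image of [A] is compact, hence closed; as it misses [0], it misses a
    ball around [0]. *)
Lemma compact_away0 f (A : set T) : compact A -> continuous f ->
  (forall x, A x -> f x != 0) -> exists2 e : C, 0 < e & forall x, A x -> e <= `|f x|.
Proof.
move=> cA cf f0.
have cfA : compact (f @` A).
  by apply: continuous_compact => //; exact: continuous_subspaceT.
have clA : closed (f @` A) by apply: compact_closed => //; exact: norm_hausdorff.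
have oA : open (~` (f @` A)) by exact: closed_openC.
have : nbhs (0 : C) (~` (f @` A)).
  apply: open_nbhs_nbhs; split=> // -[x Ax fx0].
  by have := f0 x Ax; rewrite fx0 eqxx.
move=> /nbhs_ballP[e /= e0 be]; exists e => // x Ax.
have er : e \is Num.real by rewrite gtr0_real.
rewrite real_leNgt ?normr_real //; apply/negP => fe.
by have := be (f x); rewrite -ball_normE /= sub0r normrN => /(_ fe); apply; exists x.
Qed.

End Continuity.

Section RootBound.
Local Open Scope classical_set_scope.
Variables (C : numClosedFieldType).
Hypothesis compact_disc : forall r : C, compact [set z : C | `|z| <= r].

Lemma poly_ext (p q : {poly C}) : (forall y, p.[y] = q.[y]) -> p = q.
Proof.
move=> pq; apply/eqP; rewrite -subr_eq0; apply/negPn/negP => d0.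
pose rs := [seq i%:R : C | i <- iota 0 (size (p - q))].
have := max_poly_roots (rs := rs) d0; rewrite size_map size_iota ltnn => H.
suff : false by []; apply: H.
  by apply/allP => _ /mapP[i _ ->]; rewrite /root hornerD hornerN pq subrr.
by rewrite map_inj_uniq ?iota_uniq //; apply: mulrIn; rewrite oner_eq0.
Qed.

(** Every root [zeta_l] is in the closed unit disc, so each factor of
    [lead \prod_l (z - zeta_l)] is at least [|z| - 1]; the point is that all
    factors but one stay away from zero.  The sum over [i] of the products of
    all factors but the [i]-th vanishes only where two factors vanish, that is
    at a double root [z], which the hypotheses exclude for [|z| >= 1].  By
    compactness this sum has a positive lower bound.  Since roots cannot be
    chosen continuously in [x], they enter as additional coordinates. *)
Lemma uniform_root_bound (T : topologicalType) (K : set T) (Q : T -> {poly C}) s :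
    (0 < s)%N -> compact K ->
    (forall i, continuous (fun x => (Q x)`_i)) ->
    (forall x, K x -> size (Q x) = s.+1) ->
    (forall x z, K x -> root (Q x) z ->
       `|z| <= 1 /\ (`|z| = 1 -> ~~ root (Q x)^`() z)) ->
  exists2 e : C, 0 < e & forall x z, K x -> 1 <= `|z| <= 2 ->
    e * (`|z| - 1) <= `|(Q x).[z]|.
Proof.
move=> s0 cK cQ szQ rQ.
pose lead x := (Q x)`_s.
pose ev x y := \sum_(i < s.+1) (Q x)`_i * y ^+ i.
pose fac (zeta : 'rV[C]_s) y := \prod_i (y - zeta 0 i).
(* Each evaluation point [y] gives a closed condition, and all of them
   together say that [zeta] lists the roots of [Q x] with multiplicity. *)
pose E : set (T * C * 'rV[C]_s) :=
  ((K `*` [set z : C | `|z| <= 2])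
    `*` [set v : 'rV[C]_s | forall i, [set z : C | `|z| <= 1] (v ord0 i)])
   `&` ([set p | (~` ball (0 : C) 1) p.1.2]
   `&` \bigcap_(y in [set: C]) [set p | ev p.1.1 y = lead p.1.1 * fac p.2 y]).
have c11 : continuous (fun p : T * C * 'rV[C]_s => p.1.1).
  by move=> p; apply: (cvg_comp _ _ (cvg_fst (F := nbhs p.1))); exact: cvg_fst.
have c12 : continuous (fun p : T * C * 'rV[C]_s => p.1.2).
  by move=> p; apply: (cvg_comp _ _ cvg_fst); exact: cvg_snd.
have c2 i : continuous (fun p : T * C * 'rV[C]_s => p.2 0 i).
  move=> p; apply: (@continuous_comp _ _ _ snd (fun v : 'rV[C]_s => v 0 i)).
    exact: cvg_snd.
  exact: coord_continuous.
have ccoef i : continuous (fun p : T * C * 'rV[C]_s => (Q p.1.1)`_i).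
  move=> p; apply: (@continuous_comp _ _ _ (fun p : T * C * 'rV[C]_s => p.1.1)
    (fun x => (Q x)`_i)); [exact: c11|exact: cQ].
have cE : compact E.
  have cB := compact_setX (compact_setX cK (@compact_disc 2))
    (@rV_compact C s (fun=> [set z : C | `|z| <= 1]) (fun=> @compact_disc 1)).
  apply: compact_closedI; first exact: cB.
  apply: closedI.
    apply: (@preimage_closed _ _ (fun p : T * C * 'rV[C]_s => p.1.2)) => [p _|]; first exact: c12.
    by apply: open_closedC; apply: ball_open.
  apply: closed_bigI => y _; apply: closed_fun_eq.
    by apply: continuous_fun_sum => i; apply: continuous_fun_mul => //; exact: cst_continuous.
  apply: continuous_fun_mul; first exact: ccoef.
  rewrite /fac; apply: (@continuous_fun_prod C (T * C * 'rV[C]_s)%type _ _ _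
    (fun i p => y - p.2 0 i)) => i.
  apply: continuous_fun_add; first exact: cst_continuous.
  exact: continuous_fun_opp.
pose dist1 (p : T * C * 'rV[C]_s) l : C := `|p.1.2 - p.2 0 l|.
pose f p : C := lead p.1.1 * \sum_i \prod_(l | l != i) dist1 p l.
have cf : continuous f.
  apply: continuous_fun_mul; first exact: ccoef.
  apply: continuous_fun_sum => i; apply: continuous_fun_prod => l.
  by apply: continuous_fun_norm; apply: continuous_fun_add => //; exact: continuous_fun_opp.
have evE x : K x -> ev x =1 horner (Q x).
  by move=> Kx y; rewrite horner_coef szQ.
have lead0 x : K x -> lead x != 0.
  move=> Kx; have : lead_coef (Q x) != 0 by rewrite lead_coef_eq0 -size_poly_eq0 szQ.
  by rewrite lead_coefE szQ.
have f0 p : E p -> f p != 0.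
  case: p => -[x z] zeta [[[/= Kx _] _] [/= z1 fact]].
  have {}z1 : 1 <= `|z|.
    move: z1; rewrite -ball_normE /= sub0r normrN => /negP.
    by rewrite -real_leNgt ?normr_real.
  rewrite mulf_neq0 ?lead0 //; apply/negP; rewrite psumr_eq0; last first.
    by move=> i _; apply: prodr_ge0 => l _; exact: normr_ge0.
  move=> /allP H.
  have other i : exists2 l, l != i & z = zeta 0 l.
    have := H i (mem_index_enum i); rewrite prodf_seq_eq0 => /hasP[l _ /andP[li]].
    by rewrite normr_eq0 subr_eq0 => /eqP; exists l.
  have [j _ zj] := other (Ordinal s0); have [l lj zl] := other j.
  pose g := lead x *: \prod_(i | (i != j) && (i != l)) ('X - (zeta 0 i)%:P).
  have Qg : Q x = ('X - z%:P) ^+ 2 * g.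
    apply: poly_ext => y; rewrite -evE // (fact y) // /fac (bigD1 j) // (bigD1 l) //=.
    rewrite -zj -zl hornerM horner_exp hornerXsubC hornerZ horner_prod.
    under [in RHS]eq_bigr => i _ do rewrite hornerXsubC.
    rewrite /lead /=; set u := (\prod_(_ | _) _).
    ring.
  (* [z] is a double root of [Q x] on the unit circle. *)
  have Qz : root (Q x) z by rewrite Qg /root hornerM horner_exp hornerXsubC subrr expr0n mul0r.
  have [zle1 simple] := rQ x z Kx Qz.
  have /simple/negP : `|z| = 1 by apply/eqP; rewrite eq_le zle1 z1.
  apply.
  rewrite Qg /root derivM deriv_exp !hornerD !hornerM hornerXsubC subrr.
  by rewrite expr1 hornerMn hornerM hornerXsubC subrr !(mul0r, mulr0, mul0rn) addr0.
have [e e0 fe] := compact_away0 cE cf f0.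
exists (e / s%:R); first by rewrite divr_gt0 ?ltr0n.
move=> x z Kx /andP[z1 z2].
have [r rE] := closed_field_poly_normal (Q x).
have leadE : lead_coef (Q x) = lead x by rewrite lead_coefE szQ.
have szr : size r = s.
  have := szQ x Kx; rewrite rE size_scale ?leadE ?lead0 //.
  by rewrite size_prod_XsubC => -[].
pose zeta : 'rV[C]_s := \row_i r`_i.
have QE y : (Q x).[y] = lead x * fac zeta y.
  rewrite rE hornerZ leadE horner_prod (big_nth 0) szr big_mkord; congr (_ * _).
  by apply: eq_bigr => i _; rewrite hornerXsubC mxE.
have zeta1 i : `|zeta 0 i| <= 1.
  have : root (Q x) (zeta 0 i).
    by rewrite /root QE /fac (bigD1 i) //= subrr mul0r mulr0.
  by case/(rQ x _ Kx).
have Ez : E (x, z, zeta).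
  split; first by split=> //= i; apply: zeta1.
  split=> [|y _] /=; last by rewrite evE.
  rewrite -ball_normE /= sub0r normrN; apply/negP.
  by rewrite -real_leNgt ?normr_real.
(* Summed over [i] and multiplied by the leading coefficient, [step] compares
   [(|z| - 1) f] with [s |Q x (z)|]. *)
have step i : (`|z| - 1) * \prod_(l | l != i) dist1 (x, z, zeta) l <= `|fac zeta z|.
  rewrite /fac normr_prod [leRHS](bigD1 i) //= ler_wpM2r //.
    by apply: prodr_ge0 => l _; exact: normr_ge0.
  apply: le_trans (lerB_normD _ _) => /=; rewrite ?normrN.
  by rewrite lerD2l lerN2 zeta1.
rewrite mulrAC ler_pdivrMr ?ltr0n // QE normrM -mulrA.
have -> : `|fac zeta z| * s%:R = \sum_(i < s) `|fac zeta z|.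
  by rewrite sumr_const card_ord mulr_natr.
have zm : 0 <= `|z| - 1 by rewrite subr_ge0.
apply: le_trans (ler_wpM2r zm (fe _ Ez)) _.
rewrite /f normrM /= [X in _ * X * _ <= _]ger0_norm; last first.
  by apply: sumr_ge0 => i _; apply: prodr_ge0 => l _; exact: normr_ge0.
rewrite -mulrA ler_wpM2l // mulrC mulr_sumr; apply: ler_sum => i _; exact: step.
Qed.

End RootBound.

Section Disc.
Local Open Scope classical_set_scope.
Local Open Scope complex_scope.
Variable R : realType.
Let C : numClosedFieldType := R[i].

Lemma real_complex_continuous : continuous (fun x : R => x%:C : C).
Proof.
move=> x; apply/cvg_ballP => e e0.
have [e1 ei] : 0 < complex.Re e /\ complex.Im e = 0.
  by move: e0; rewrite ltcE /= => /andP[/eqP -> ?].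
have eE : e = (complex.Re e)%:C by rewrite [LHS]complexE ei mulr0 addr0.
apply/nbhs_ballP; exists (complex.Re e) => //= y.
rewrite -!ball_normE /= -rmorphB eE normc_def /=.
by rewrite expr0n /= addr0 sqrtr_sqr ltcR.
Qed.

Lemma compact_disc (r : C) : compact [set z : C | `|z| <= r].
Proof.
pose q := complex.Re r.
pose g (p : R * R) : C := p.1%:C + 'i * p.2%:C.
have cg : continuous g.
  apply: continuous_fun_add.
    move=> p; apply: (@continuous_comp _ _ _ fst (fun x : R => x%:C : C)).
      exact: cvg_fst.
    exact: real_complex_continuous.
  apply: continuous_fun_mul; first exact: cst_continuous.
  move=> p; apply: (@continuous_comp _ _ _ snd (fun x : R => x%:C : C)).
    exact: cvg_snd.
  exact: real_complex_continuous.
have cS : compact (g @` (`[- q, q] `*` `[- q, q])).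
  apply: continuous_compact; first exact: continuous_subspaceT.
  by apply: compact_setX; exact: segment_compact.
apply: subclosed_compact cS _.
  (* This form is an equality between continuous functions of [z]. *)
  have -> : [set z : C | `|z| <= r] = [set z : C | `|r - `|z| | = r - `|z|].
    by apply/seteqP; split=> z /=; rewrite -subr_ge0 ger0_def => /eqP.
  have c : continuous (fun z : C => r - `|z|).
    apply: continuous_fun_add; first exact: cst_continuous.
    by apply: continuous_fun_opp; exact: norm_continuous.
  exact: (closed_fun_eq (continuous_fun_norm c) c).
move=> [x y] /=; rewrite normc_def lecE /= => /andP[_ xyr].
exists (x, y); last by rewrite /g /= [RHS]complexE.
have bound t u : Num.sqrt (t ^+ 2 + u ^+ 2) <= q -> (`[- q, q] : set R) t.
  move=> tu; rewrite /= in_itv /= -ler_norml -sqrtr_sqr (le_trans _ tu) //.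
  by rewrite ler_sqrt ?lerDl ?addr_ge0 ?sqr_ge0.
split=> /=; first exact: bound xyr.
by apply: (bound y x); rewrite addrC.
Qed.

End Disc.

(** * Real powers of the definite matrix and their quadratic forms *)

Section Cdot.
Local Open Scope sesquilinear_scope.
Local Open Scope complex_scope.
Variables (R : realType) (N : nat).
Implicit Types (v w : 'cV[R[i]]_N) (M : 'M[R[i]]_N).

Lemma cdotDr v w1 w2 : cdot v (w1 + w2) = cdot v w1 + cdot v w2.
Proof. by rewrite /cdot mulmxDr mxE. Qed.

Lemma cdotDl v1 v2 w : cdot (v1 + v2) w = cdot v1 w + cdot v2 w.
Proof. by rewrite /cdot linearD /= map_mxD mulmxDl mxE. Qed.

Lemma cdotZr v w (t : R[i]) : cdot v (t *: w) = t * cdot v w.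
Proof. by rewrite /cdot -scalemxAr mxE. Qed.

Lemma cdotBr v w1 w2 : cdot v (w1 - w2) = cdot v w1 - cdot v w2.
Proof. by rewrite /cdot mulmxBr !mxE. Qed.

Lemma cdotZl v w (t : R[i]) : cdot (t *: v) w = t^* * cdot v w.
Proof. by rewrite /cdot linearZ /= map_mxZ -scalemxAl mxE. Qed.

Lemma cdot_sumr (I : Type) (r : seq I) v (w : I -> 'cV[R[i]]_N) :
  cdot v (\sum_(i <- r) w i) = \sum_(i <- r) cdot v (w i).
Proof. by rewrite /cdot mulmx_sumr summxE. Qed.

Lemma cdot_norm1 v w : `|cdot v w| <= norm1 v * norm1 w.
Proof.
rewrite -norm1_11 (le_trans (norm1M _ _)) // (_ : norm1 (v^t*) = norm1 v) //.
rewrite -[RHS]norm1_tr; apply: eq_bigr => i _; apply: eq_bigr => j _.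
by rewrite !mxE norm_conjC.
Qed.

Lemma cdotE v w : cdot v w = \sum_i (v i 0)^* * w i 0.
Proof. by rewrite /cdot mxE; apply: eq_bigr => i _; rewrite !mxE. Qed.

Lemma cdot_diag v (d : 'rV[R]_N) :
  cdot v (diag_mx (map_mx (real_complex R) d) *m v)
    = (\sum_i d 0 i * Normc.normc (v i 0) ^+ 2)%:C.
Proof.
rewrite cdotE rmorph_sum; apply: eq_bigr => i _.
rewrite mul_diag_mx !mxE rmorphM rmorphXn /= mulrCA -[_^* * _]mulrC -normCK.
by congr (_ * _ ^+ 2); rewrite normc_def; case: (v i 0).
Qed.

Lemma cdot_adj v w M : cdot v (M *m w) = cdot (M^t* *m v) w.
Proof. by rewrite /cdot trmx_mul map_mxM trmxCK mulmxA. Qed.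

End Cdot.

Lemma conj_real_complex (R : realType) (x : R) : Num.conj (x%:C%C : R[i]) = x%:C%C.
Proof. exact: conjc_real. Qed.

Section PowerForms.
Local Open Scope sesquilinear_scope.
Local Open Scope complex_scope.
Variables (R : realType) (N : nat) (A : 'M[R]_N).
Hypothesis Asym : A^T = A.
Hypothesis Aneg : neg_definite A.
Let H := cplxmx (- A).
Let P := spectralmx H.
Let d : 'rV[R]_N := map_mx (@complex.Re R) (spectral_diag H).

Lemma cplxmx_opp_hermitian : H^t* = H.
Proof.
apply/matrixP => i j; rewrite !mxE conj_real_complex.
by rewrite -[in LHS]Asym mxE.
Qed.

Lemma invmx_spectral : invmx P = P^t*.
Proof. exact: invmx_unitary (spectral_unitarymx H). Qed.

Lemma cplxmx_spectral : H = P^t* *m diag_mx (map_mx (real_complex R) d) *m P.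
Proof.
have Hh : H \is hermsymmx.
  by apply/is_hermitianmxP; rewrite expr0 scale1r cplxmx_opp_hermitian.
have -> : map_mx (real_complex R) d = spectral_diag H.
  apply/rowP => i; have /mxOverP/(_ 0 i) := hermitian_spectral_diag_real Hh.
  by rewrite !mxE; exact: RRe_real.
rewrite -invmx_spectral; apply/orthomx_spectralP; exact: hermitian_normalmx.
Qed.

(** In terms of the real and imaginary parts of [v] the cross terms cancel,
    because [A] is symmetric. *)
Lemma cdot_cplxmx_gt0 v : v != 0 -> 0 < complex.Re (cdot v (H *m v)).
Proof.
move=> v0; pose x := map_mx (@complex.Re R) v; pose y := map_mx (@complex.Im R) v.
pose emb := map_mx (real_complex R) : 'cV[R]_N -> 'cV[R[i]]_N.
have vE : v = emb x + 'i *: emb y.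
  by apply/colP => i; rewrite !mxE [LHS]complexE.
have form (u w : 'cV[R]_N) : cdot (emb u) (H *m emb w) = ((u^T *m (- A) *m w) 0 0)%:C.
  rewrite /cdot /H /cplxmx /emb map_trmx -map_mx_comp.
  rewrite (_ : map_mx (_ \o _) _ = map_mx (real_complex R) u^T); last first.
    by apply/matrixP => i j; rewrite !mxE /= conj_real_complex.
  by rewrite mulmxA -!map_mxM mxE.
have sym (u w : 'cV[R]_N) : (u^T *m (- A) *m w) 0 0 = (w^T *m (- A) *m u) 0 0.
  have -> : u^T *m (- A) *m w = (w^T *m (- A) *m u)^T.
    have NAsym : (- A)^T = - A by rewrite linearN /= Asym.
    by rewrite !trmx_mul trmxK NAsym mulmxA.
  by rewrite mxE.
have pos (u : 'cV[R]_N) : u != 0 -> 0 < (u^T *m (- A) *m u) 0 0.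
  by move=> /Aneg Au; rewrite mulmxN mulNmx mxE oppr_gt0.
have pos0 (u : 'cV[R]_N) : 0 <= (u^T *m (- A) *m u) 0 0.
  by have [->|/pos/ltW//] := eqVneq u 0; rewrite mulmx0 mxE.
have -> : cdot v (H *m v) =
    ((x^T *m (- A) *m x) 0 0 + (y^T *m (- A) *m y) 0 0)%:C.
  rewrite vE mulmxDr -scalemxAr !cdotDr !cdotZr !cdotDl !cdotZl !form.
  rewrite (sym y x) rmorphD conjCi /=; move: (_%:C) (_%:C) (_%:C) => p q r.
  transitivity (r - 'i ^+ 2 * p); first by ring.
  by rewrite sqrCi mulN1r opprK.
rewrite /=.
have [x0|x0] := eqVneq x 0; last by rewrite ltr_pwDl ?pos.
have [y0|y0] := eqVneq y 0; last by rewrite ltr_wpDl ?pos.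
by move: v0; rewrite vE x0 y0 /emb !map_mx0 scaler0 addr0 eqxx.
Qed.

(** The form at the [i]-th vector of the orthonormal eigenbasis is the [i]-th
    eigenvalue. *)
Lemma spectral_gt0 i : 0 < d 0 i.
Proof.
pose v : 'cV[R[i]]_N := P^t* *m delta_mx i 0.
have Pv : P *m v = delta_mx i 0.
  by rewrite /v mulmxA (unitarymxP (spectral_unitarymx H)) mul1mx.
have v0 : v != 0.
  apply/eqP => v0; move/eqP: Pv; rewrite v0 mulmx0 => /eqP/matrixP/(_ i 0)/eqP.
  by rewrite !mxE !eqxx eq_sym oner_eq0.
have := cdot_cplxmx_gt0 v0; rewrite {1}cplxmx_spectral -!mulmxA cdot_adj trmxCK Pv cdot_diag /=.
rewrite (bigD1 i) //= big1 ?addr0 => [|j ji].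
  rewrite (_ : delta_mx i 0 i 0 = 1 :> R[i]); last by rewrite mxE !eqxx.
  by rewrite /Normc.normc /= expr0n expr1n addr0 sqrtr1 expr1n mulr1.
rewrite (_ : delta_mx i 0 j 0 = 0 :> R[i]); last by rewrite mxE (negPf ji).
by rewrite /Normc.normc /= expr0n addr0 sqrtr0 expr0n mulr0.
Qed.

Lemma mxpowR_spectral p : mxpowR H p =
  P^t* *m diag_mx (map_mx (real_complex R) (\row_i d 0 i `^ p)) *m P.
Proof.
rewrite -invmx_spectral (_ : map_mx _ (\row_i _) =
  map_mx (fun z => (complex.Re z `^ p)%:C) (spectral_diag H)) //.
by apply/rowP => i; rewrite !mxE.
Qed.

Lemma cdot_mxpowR_gt0 p v : v != 0 ->
  exists2 x : R, 0 < x & cdot v (mxpowR H p *m v) = x%:C.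
Proof.
move=> v0; rewrite mxpowR_spectral -!mulmxA cdot_adj trmxCK cdot_diag.
eexists; last reflexivity.
have Pv0 : P *m v != 0.
  by apply: contraNneq v0 => Pv; rewrite -(mulKmx (spectral_unit H) v) Pv mulmx0.
have [i Pvi] : exists i, (P *m v) i 0 != 0.
  apply/existsP; apply: contraNT Pv0 => /existsPn h; apply/eqP/colP => i.
  by rewrite [RHS]mxE; apply/eqP; rewrite -[_ == _]negbK; exact: h.
rewrite (bigD1 i) //= ltr_pwDl //.
  rewrite mulr_gt0 //; first by rewrite mxE powR_gt0 ?spectral_gt0.
  by rewrite exprn_even_gt0 //=; apply: contraNneq Pvi => /Normc.eq0_normc ->.
by apply: sumr_ge0 => j _; rewrite mulr_ge0 ?sqr_ge0 // mxE powR_ge0.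
Qed.

Lemma mxpowR_pred_mul p : mxpowR H (p - 1) *m H = mxpowR H p.
Proof.
rewrite !mxpowR_spectral {1}cplxmx_spectral.
rewrite !mulmxA -[_ *m P *m P^t*]mulmxA (unitarymxP (spectral_unitarymx H)) mulmx1.
rewrite -!mulmxA; congr (_ *m _); rewrite !mulmxA; congr (_ *m _).
rewrite mulmx_diag; congr diag_mx; apply/rowP => i; rewrite !mxE -rmorphM /=.
have := spectral_gt0 i; rewrite mxE; set t := complex.Re _ => t0; congr _%:C.
rewrite -{2}[t]powRr1 ?(ltW t0) // -powRD ?subrK //.
by rewrite (gt_eqF t0) implybT.
Qed.

End PowerForms.

(** * The scalar polynomials of the weighted numerical range *)

Lemma coef_coefpoly (R : realType) s (a : 'I_s.+1 -> R) i :
  (coefpoly a)`_i = if (i < s.+1)%N then (a (inord i))%:C%C else 0.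
Proof.
have -> : coefpoly a = \poly_(i < s.+1) (a (inord i))%:C%C.
  by rewrite poly_def; apply: eq_bigr => j _; rewrite inord_val.
exact: coef_poly.
Qed.

Lemma horner_coefpoly (R : realType) s (a : 'I_s.+1 -> R) z :
  (coefpoly a).[z] = \sum_j (a j)%:C%C * z ^+ j.
Proof. by rewrite horner_sum; apply: eq_bigr => j _; rewrite hornerZ hornerXn. Qed.

Lemma continuous_fun_conj (C : numClosedFieldType) (T : topologicalType) (f : T -> C) :
  continuous f -> continuous (fun x => Num.conj (f x) : C).
Proof.
move=> cf x; apply: (@continuous_comp _ _ _ f (Num.conj : C -> C)); first exact: cf.
move=> U /nbhs_ballP[e e0 eU]; apply/nbhs_ballP; exists e => // y fy.
by apply: eU; move: fy; rewrite -!ball_normE /= -rmorphB norm_conjC.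
Qed.

Section Range.
Local Open Scope sesquilinear_scope.
Local Open Scope complex_scope.
Variables (R : realType) (N s : nat) (A B : 'M[R]_N) (a b c : 'I_s.+1 -> R) (p : R).
Hypotheses (Asym : A^T = A) (Aneg : neg_definite A) (s_gt0 : (0 < s)%N).
Hypotheses (bs0 : b ord_max = 0) (as0 : a ord_max != 0) (cs0 : c ord_max != 0).
Hypothesis solv : forall k : R, 0 < k ->
  (a ord_max)%:M - (k * c ord_max) *: A \in unitmx.
Hypothesis azero : zero_stable a.
Hypothesis WD : (Wset A B p `<=` Dregion a b c)%classic.
Let H := cplxmx (- A).

Definition alpha (v : 'cV[R[i]]_N) := cdot v (mxpowR H (p - 1) *m v).
Definition beta (v : 'cV[R[i]]_N) := cdot v (mxpowR H p *m v).
Definition gamma (v : 'cV[R[i]]_N) := cdot v (mxpowR H (p - 1) *m cplxmx B *m v).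

(** The quadratic form of the weighted symbol of the scheme, for the time step
    [k = 1 / x - 1]; see [cdot_symbol]. *)
Definition rangepoly (x : R) v : {poly R[i]} :=
  (x%:C * alpha v) *: coefpoly a
  + (1 - x)%:C *: (beta v *: coefpoly c - gamma v *: coefpoly b).

(** For opposite signs, [a_s + k c_s d] would vanish at some [k > 0] for an
    eigenvalue [d] of [- A], against the solvability of the scheme.  The vector
    [v] ensures that the space is not zero, so that [- A] has an eigenvalue. *)
Lemma lead_same_sign (v : 'cV[R[i]]_N) : v != 0 -> 0 < a ord_max * c ord_max.
Proof.
move=> v0.
have [i _] : exists i, v i 0 != 0.
  apply/existsP; apply: contraNT v0 => /existsPn h; apply/eqP/colP => i.
  by rewrite [RHS]mxE; apply/eqP; rewrite -[_ == _]negbK; exact: h.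
rewrite lt_def mulf_neq0 //= leNgt; apply/negP => ac.
have di := spectral_gt0 Asym Aneg i; move: di; set d := _ 0 i => di.
pose k := - (a ord_max) / (c ord_max * d).
have k0 : 0 < k.
  have -> : k = - (a ord_max * c ord_max) / (c ord_max ^+ 2 * d).
    by rewrite /k; field; rewrite cs0 gt_eqF.
  by rewrite divr_gt0 ?oppr_gt0 // mulr_gt0 // exprn_even_gt0.
have := solv k0; rewrite -(map_unitmx (real_complex R)) => U.
pose P := spectralmx H; pose u := P^t* *m delta_mx i 0 : 'cV[R[i]]_N.
have Pu : P *m u = delta_mx i 0.
  by rewrite /u mulmxA (unitarymxP (spectral_unitarymx H)) mul1mx.
have Hu : H *m u = d%:C *: u.
  rewrite {1}/H (cplxmx_spectral Asym) -!mulmxA -/H -/P Pu /u scalemxAr; congr (_ *m _).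
  apply/colP => j; rewrite mul_diag_mx !mxE.
  by case: eqVneq => [->|]; rewrite ?(mulr0, mulr1) /d ?mxE.
have : map_mx (real_complex R) ((a ord_max)%:M - (k * c ord_max) *: A) *m u = 0.
  rewrite -scalerN map_mxD map_mxZ map_scalar_mx mulmxDl mul_scalar_mx -scalemxAl.
  rewrite -/(cplxmx _) -/H Hu scalerA -scalerDl -rmorphM -rmorphD /=.
  by rewrite (_ : _ + _ = 0) ?rmorph0 ?scale0r // /k; field; rewrite cs0 gt_eqF.
set M := map_mx _ _ in U *; move/(congr1 (mulmx (invmx M))).
rewrite mulKmx // mulmx0 => u0.
by move/colP/(_ i)/eqP: Pu; rewrite u0 mulmx0 !mxE !eqxx eq_sym oner_eq0.
Qed.

Lemma alpha_gt0 v : v != 0 -> exists2 x : R, 0 < x & alpha v = x%:C.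
Proof. exact: cdot_mxpowR_gt0. Qed.

Lemma beta_gt0 v : v != 0 -> exists2 x : R, 0 < x & beta v = x%:C.
Proof. exact: cdot_mxpowR_gt0. Qed.

Lemma lead_rangepoly x v : (rangepoly x v)`_s =
  x%:C * alpha v * (a ord_max)%:C + (1 - x)%:C * (beta v * (c ord_max)%:C).
Proof.
rewrite /rangepoly coefD !coefZ coefB !coefZ !coef_coefpoly ltnSn.
rewrite (_ : inord s = ord_max); last by apply: val_inj; rewrite /= inordK.
by rewrite bs0 mulr0 subr0.
Qed.

(** Multiplied by [c_s], the leading coefficient is a convex combination of
    two positive numbers: no root escapes to infinity as [x] varies. *)
Lemma size_rangepoly x v : v != 0 -> 0 <= x <= 1 -> size (rangepoly x v) = s.+1.
Proof.
move=> v0 /andP[x0 x1]; apply/anti_leq/andP; split.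
  apply/leq_sizeP => j sj; rewrite /rangepoly coefD !coefZ coefB !coefZ !coef_coefpoly.
  by rewrite ltnNge sj /= !mulr0 subrr mulr0 addr0.
rewrite ltnNge; apply/negP => /leq_sizeP/(_ s (leqnn s)).
rewrite lead_rangepoly; have [al al0 ->] := alpha_gt0 v0; have [be be0 ->] := beta_gt0 v0.
rewrite -!rmorphM -rmorphD /= => /(congr1 (@complex.Re R)) /= /(congr1 ( *%R (c ord_max))).
rewrite mulr0 => e0.
have ac := lead_same_sign v0.
have c2 : 0 < c ord_max ^+ 2 by rewrite exprn_even_gt0.
have : 0 < c ord_max * (x * al * a ord_max + (1 - x) * (be * c ord_max)).
  have -> : c ord_max * (x * al * a ord_max + (1 - x) * (be * c ord_max)) =
     x * (al * (a ord_max * c ord_max)) + (1 - x) * (be * c ord_max ^+ 2) by ring.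
  have [->|xn0] := eqVneq x 0; first by rewrite mul0r add0r subr0 mul1r (mulr_gt0 be0).
  have xp : 0 < x by rewrite lt_def xn0.
  apply: ltr_pwDl; first by rewrite (mulr_gt0 xp) ?(mulr_gt0 al0).
  by rewrite mulr_ge0 ?subr_ge0 ?(ltW (mulr_gt0 be0 c2)).
by rewrite e0 ltxx.
Qed.

(** The quotient is unchanged when [v] is rescaled to the normalisation in
    the definition of [W_p]. *)
Lemma gamma_beta_D v : v != 0 -> Dregion a b c (gamma v / beta v).
Proof.
move=> v0; apply: WD; have [be be0 beE] := beta_gt0 v0.
pose t := Num.sqrt be^-1.
have tt (M : 'M[R[i]]_N) :
    cdot (t%:C *: v) (M *m (t%:C *: v)) = cdot v (M *m v) / be%:C.
  rewrite -scalemxAr cdotZr cdotZl conj_real_complex mulrA -rmorphM /=.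
  by rewrite -expr2 sqr_sqrtr ?invr_ge0 ?ltW // fmorphV mulrC.
exists (t%:C *: v) => /=; last by rewrite tt beE.
by rewrite tt -/(beta v) beE divff // fmorph_eq0 gt_eqF.
Qed.

(** Division by [x alpha] gives the equation of the region [D_y] with
    [y = - (1 - x) beta / (x alpha)]; for [x = 0] it is that of [D_-oo]. *)
Lemma rangepoly_root_lt1 x v z : v != 0 -> 0 <= x < 1 -> root (rangepoly x v) z -> `|z| < 1.
Proof.
move=> v0 /andP[x0 x1]; rewrite /root /rangepoly !hornerE => /eqP.
have [Dinf Dy] := gamma_beta_D v0.
have [al al0 ->] := alpha_gt0 v0; have [be be0 beE] := beta_gt0 v0.
rewrite beE in Dinf Dy *.
have beC : be%:C != 0 :> R[i] by rewrite fmorph_eq0 gt_eqF.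
have [->|xn0] := eqVneq x 0.
  rewrite mul0r mul0r add0r subr0 mul1r => e; apply: Dinf.
  rewrite /root !hornerE; apply/eqP; apply: (mulfI beC).
  by rewrite mulr0 -[RHS]e; field.
move=> e; pose y := - ((1 - x) * be / (x * al)).
have xp : 0 < x by rewrite lt_def xn0.
have y0 : y < 0 by rewrite oppr_lt0 divr_gt0 ?mulr_gt0 // subr_gt0.
have alC : al%:C != 0 :> R[i] by rewrite fmorph_eq0 gt_eqF.
have xC : x%:C != 0 :> R[i] by rewrite fmorph_eq0 gt_eqF.
apply: (Dy y y0); rewrite /y; apply: (mulfI (mulf_neq0 xC alC)).
apply/eqP; rewrite -subr_eq0 -e; apply/eqP.
rewrite !(rmorphN, rmorphM, fmorphV) /=.
field.
by rewrite ?beC ?alC ?xC.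
Qed.

Lemma rangepoly_root_condition x v z : v != 0 -> 0 <= x <= 1 -> root (rangepoly x v) z ->
  `|z| <= 1 /\ (`|z| = 1 -> ~~ root (rangepoly x v)^`() z).
Proof.
move=> v0 /andP[x0 x1] rz; have [xe|xn] := eqVneq x 1; last first.
  have zlt : `|z| < 1 by apply: rangepoly_root_lt1 rz => //; rewrite x0 lt_neqAle xn.
  by split=> [|z1]; [exact: ltW|move: zlt; rewrite z1 ltxx].
have [al al0 alE] := alpha_gt0 v0.
have alC : al%:C != 0 :> R[i] by rewrite fmorph_eq0 gt_eqF.
have qE : rangepoly x v = al%:C *: coefpoly a.
  by rewrite /rangepoly xe alE mul1r subrr scale0r addr0.
move: rz; rewrite qE derivZ rootZ // => rz.
have [z1 simple] := azero rz; split=> // /simple; by rewrite rootZ.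
Qed.

Lemma rangepolyZ x v (t : R[i]) : t \is Num.real ->
  rangepoly x (t *: v) = t ^+ 2 *: rangepoly x v.
Proof.
move=> /conj_Creal tr.
have q (M : 'M[R[i]]_N) : cdot (t *: v) (M *m (t *: v)) = t ^+ 2 * cdot v (M *m v).
  by rewrite -scalemxAr cdotZr cdotZl tr mulrA -expr2.
rewrite /rangepoly.
have -> : alpha (t *: v) = t ^+ 2 * alpha v by exact: q.
have -> : beta (t *: v) = t ^+ 2 * beta v by exact: q.
have -> : gamma (t *: v) = t ^+ 2 * gamma v by exact: q.
rewrite [RHS]scalerDr; congr (_ + _).
  by rewrite scalerA mulrCA.
by rewrite !scalerBr !scalerA; congr (_ *: _ - _ *: _); ring.
Qed.

(** Both sides are homogeneous of degree two in [v], so it is enough to treat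
    the compact set of pairs [(x, v)] with [norm1 v = 1]. *)
Lemma rangepoly_bound : exists2 e : R[i], 0 < e &
  forall (x : R) v z, 0 <= x <= 1 -> 1 <= `|z| <= 2 ->
    e * (`|z| - 1) * norm1 v ^+ 2 <= `|(rangepoly x v).[z]|.
Proof.
pose C : numClosedFieldType := R[i].
pose T : topologicalType := (R * 'rV[C]_N)%type.
pose K : set T := ((`[0, 1]
    `*` [set v : 'rV[C]_N | forall i, [set z : C | `|z| <= 1] (v ord0 i)])
   `&` [set x : R * 'rV[C]_N | \sum_i `|x.2 0 i| = 1])%classic.
pose Q (x : T) : {poly C} := rangepoly x.1 x.2^T.
have c1 : continuous (fun x : T => x.1%:C : C).
  move=> x; apply: (@continuous_comp _ _ _ fst (fun y : R => y%:C : C)).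
    exact: cvg_fst.
  exact: real_complex_continuous.
have c1' : continuous (fun x : T => (1 - x.1)%:C : C).
  have -> : (fun x : T => (1 - x.1)%:C : C) = (fun x : T => 1 - x.1%:C : C).
    by apply/funext => x; rewrite rmorphB.
  by apply: continuous_fun_add; [exact: cst_continuous|exact: continuous_fun_opp].
have c2 i : continuous (fun x : T => x.2 0 i : C).
  move=> x; apply: (@continuous_comp _ _ _ snd (fun v : 'rV[C]_N => v 0 i)).
    exact: cvg_snd.
  exact: coord_continuous.
have ccdot (M : 'M[R[i]]_N) : continuous (fun x : T => cdot x.2^T (M *m x.2^T) : C).
  have -> : (fun x : T => cdot x.2^T (M *m x.2^T) : C) =
      (fun x : T => \sum_i Num.conj (x.2 0 i) * \sum_j M i j * x.2 0 j : C).
    apply/funext => x; rewrite cdotE; apply: eq_bigr => i _; rewrite !mxE.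
    by congr (_ * _); apply: eq_bigr => j _; rewrite mxE.
  apply: (@continuous_fun_sum C T _ _ _
    (fun i x => Num.conj (x.2 0 i) * \sum_j M i j * x.2 0 j)) => i.
  apply: continuous_fun_mul; first exact: (continuous_fun_conj (c2 i)).
  apply: (@continuous_fun_sum C T _ _ _ (fun j x => M i j * x.2 0 j)) => j.
  by apply: continuous_fun_mul; [exact: cst_continuous|exact: c2].
have cQ i : continuous (fun x : T => (Q x)`_i : C).
  have -> : (fun x : T => (Q x)`_i : C) = (fun x : T =>
      x.1%:C * cdot x.2^T (mxpowR H (p - 1) *m x.2^T) * (coefpoly a)`_i
      + (1 - x.1)%:C * (cdot x.2^T (mxpowR H p *m x.2^T) * (coefpoly c)`_i
         + - (cdot x.2^T (mxpowR H (p - 1) *m cplxmx B *m x.2^T) * (coefpoly b)`_i))).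
    by apply/funext => x; rewrite /Q /rangepoly coefD !coefZ coefB !coefZ.
  have cc (y : C) : continuous (fun _ : T => y) by exact: cst_continuous.
  have cform M (y : C) := continuous_fun_mul (ccdot M) (cc y).
  apply: (continuous_fun_add (continuous_fun_mul (continuous_fun_mul c1 (ccdot _)) (cc _))).
  apply: (continuous_fun_mul c1').
  exact: (continuous_fun_add (cform _ _) (continuous_fun_opp (cform _ _))).
have cK : compact K.
  have cB := compact_setX (@segment_compact R 0 1)
    (@rV_compact C N (fun=> [set z : C | `|z| <= 1]%classic) (fun=> @compact_disc R 1)).
  apply: compact_closedI; first exact: cB.
  apply: closed_fun_eq; last exact: cst_continuous.
  apply: (@continuous_fun_sum C T _ _ _ (fun i x => `|x.2 0 i|)) => i.
  exact: (continuous_fun_norm (c2 i)).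
have K01 (x : T) : K x -> 0 <= x.1 <= 1 by case=> -[/=]; rewrite in_itv.
have Kn0 (x : T) : K x -> x.2^T != 0.
  case=> _ /= x1; apply/eqP => x0; move/eqP: x1; rewrite big1 ?(eq_sym 0) ?oner_eq0 // => i _.
  by have /colP/(_ i) := x0; rewrite !mxE => ->; rewrite normr0.
have [e e0 He] := @uniform_root_bound C (@compact_disc R) T K Q s s_gt0 cK cQ
  (fun x Kx => size_rangepoly (Kn0 x Kx) (K01 x Kx))
  (fun x z Kx => rangepoly_root_condition (Kn0 x Kx) (K01 x Kx)).
exists e => // x v z x01 z12.
have [->|v0] := eqVneq v 0.
  by rewrite norm1_0 expr0n mulr0 normr_ge0.
set n := norm1 v; have n0 : 0 < n.
  rewrite lt_def norm1_ge0 andbT; apply: contraNneq v0 => n0.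
  by rewrite [v]norm1_eq0 // -/n n0.
have nr : n^-1 \is Num.real by rewrite rpredV gtr0_real.
have Kv : K (x, (n^-1 *: v)^T).
  have nv : norm1 (n^-1 *: v) = 1.
    by rewrite norm1Z ger0_norm ?invr_ge0 ?(ltW n0) // mulVf ?gt_eqF.
  split; last first.
    by rewrite /= -nv /norm1; apply: eq_bigr => i _; rewrite big_ord1 !mxE.
  split=> /= [|i]; first by rewrite in_itv.
  by rewrite -nv mxE norm1_entry.
have := He _ z Kv z12; rewrite /Q /= trmxK rangepolyZ // hornerZ normrM.
rewrite normrX ger0_norm ?invr_ge0 ?(ltW n0) // exprVn [leRHS]mulrC => h.
by rewrite -ler_pdivlMr ?exprn_gt0.
Qed.

End Range.

(** * Stability of the scheme *)

Section Norms.
Local Open Scope complex_scope.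
Variables (R : realType) (N : nat).

Lemma norm1_real m n (M : 'M[R]_(m, n)) :
  norm1 (map_mx (real_complex R) M) = (norm1 M)%:C.
Proof.
rewrite rmorph_sum; apply: eq_bigr => i _; rewrite rmorph_sum; apply: eq_bigr => j _.
by rewrite mxE normc_def /= expr0n addr0 sqrtr_sqr.
Qed.

Lemma enorm_sqr (x : 'cV[R]_N) : enorm x ^+ 2 = \sum_i `|x i 0| ^+ 2.
Proof.
have xx : (x^T *m x) 0 0 = \sum_i `|x i 0| ^+ 2.
  by rewrite mxE; apply: eq_bigr => i _; rewrite mxE real_normK ?num_real.
by rewrite /enorm xx sqr_sqrtr // sumr_ge0 // => i _; rewrite sqr_ge0.
Qed.

Lemma enorm_le_norm1 (x : 'cV[R]_N) : enorm x <= norm1 x.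
Proof.
rewrite -(@ler_pXn2r _ 2) ?nnegrE ?sqrtr_ge0 ?norm1_ge0 // enorm_sqr.
rewrite expr2 [in leRHS]/norm1 mulr_suml; apply: ler_sum => i _.
by rewrite big_ord1 expr2 ler_wpM2l // norm1_entry.
Qed.

Lemma norm1_le_mul_enorm (x : 'cV[R]_N) : norm1 x <= N%:R * enorm x.
Proof.
rewrite mulr_natl -[X in _ *+ X]card_ord -sumr_const; apply: ler_sum => i _.
rewrite big_ord1 -(@ler_pXn2r _ 2) ?nnegrE ?sqrtr_ge0 // enorm_sqr.
by rewrite (bigD1 i) //= lerDl sumr_ge0 // => j _; rewrite sqr_ge0.
Qed.

End Norms.

Section Pencil.
Local Open Scope complex_scope.
Variables (R : realType) (N s : nat) (A B : 'M[R]_N) (a b c : 'I_s.+1 -> R).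

(** The coefficients of the scheme multiplied by [k / (1 + k)], with
    [x = 1 / (1 + k)]. *)
Definition pencil (x : R) (j : 'I_s.+1) : 'M[R]_N :=
  (x * a j)%:M - (1 - x) *: (c j *: A + b j *: B).

Lemma norm1_pencil x : 0 <= x <= 1 ->
  \sum_j norm1 (pencil x j) <=
  \sum_j (`|a j| * norm1 (1%:M : 'M[R]_N) + norm1 (c j *: A + b j *: B)).
Proof.
move=> /andP[x0 x1]; apply: ler_sum => j _; rewrite (le_trans (norm1D _ _)) //.
rewrite norm1N -scalemx1 !norm1Z normrM lerD //.
  by rewrite ler_wpM2r ?norm1_ge0 // ler_piMl // ger0_norm.
by rewrite ler_piMl ?norm1_ge0 // ger0_norm ?subr_ge0 // gerBl.
Qed.

Lemma scheme_recurrence (k : R) (u : nat -> 'cV[R]_N) n : 0 < k ->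
    scheme_solution A B a b c k (fun=> 0) u ->
  recurrence (pencil (1 + k)^-1) u n = 0.
Proof.
move=> k0 /(_ n) /(congr1 ( *:%R k)); rewrite scalerA mulfV ?gt_eqF // scale1r => e.
have k1 : 1 + k != 0 by rewrite gt_eqF // addr_gt0.
apply: (scalerI k1); rewrite scaler0 /recurrence scaler_sumr.
transitivity (\sum_(j < s.+1) a j *: u (n + j)%N - k *: \sum_(j < s.+1)
    (c j *: (A *m u (n + j)%N) + b j *: (B *m u (n + j)%N) + b j *: 0)); last first.
  by rewrite e subrr.
rewrite scaler_sumr -sumrB.
apply: eq_bigr => j _; rewrite scaler0 addr0.
rewrite /pencil mulmxBl mul_scalar_mx -scalemxAl mulmxDl -!scalemxAl scalerBr !scalerA.
by congr (_ *: _ - _ *: _); field.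
Qed.

Lemma pencil_unit x : b ord_max = 0 -> 0 < x < 1 ->
    (forall k : R, 0 < k -> (a ord_max)%:M - (k * c ord_max) *: A \in unitmx) ->
  pencil x ord_max \in unitmx.
Proof.
move=> b0 /andP[x0 x1] solv.
have -> : pencil x ord_max =
    x *: ((a ord_max)%:M - ((1 - x) / x * c ord_max) *: A).
  rewrite /pencil b0 scale0r addr0 scalerBr scale_scalar_mx !scalerA.
  by congr (_ - _ *: _); field; rewrite gt_eqF.
by rewrite unitmxZ ?unitfE ?gt_eqF // solv // divr_gt0 // subr_gt0.
Qed.

Variable p : R.
Hypotheses (Asym : A^T = A) (Aneg : neg_definite A).
Let H := cplxmx (- A).

(** The weight [(-A)^(p-1)] turns [1], [- A] and [B] into the matrices whose
    quadratic forms are [alpha], [beta] and [gamma]. *)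
Lemma cdot_symbol x v z :
  cdot v (mxpowR H (p - 1) *m symbol (fun j => cplxmx (pencil x j)) z v)
    = (rangepoly A B a b c p x v).[z].
Proof.
rewrite /symbol mulmx_sumr cdot_sumr /rangepoly !hornerE !horner_coefpoly.
have HA : mxpowR H (p - 1) *m cplxmx A = - mxpowR H p.
  have -> : cplxmx A = - H by rewrite /H /cplxmx map_mxN opprK.
  by rewrite mulmxN (mxpowR_pred_mul Asym Aneg p).
rewrite /alpha /beta /gamma -/H.
move: (mxpowR H (p - 1)) (mxpowR H p) HA => S T HA.
rewrite !mulr_sumr -sumrB mulr_sumr -big_split; apply: eq_bigr => j _ /=.
rewrite -scalemxAr cdotZr mulmxA.
have -> : S *m cplxmx (pencil x j) = (x * a j)%:C *: S
    + (1 - x)%:C *: ((c j)%:C *: T - (b j)%:C *: (S *m cplxmx B)).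
  rewrite /cplxmx /pencil map_mxD map_mxN map_scalar_mx map_mxZ map_mxD !map_mxZ.
  rewrite mulmxDr mul_mx_scalar mulmxN -scalemxAr mulmxDr -!scalemxAr -/(cplxmx _) HA.
  by rewrite scalerN -[X in _ + X]scalerN opprD opprK.
rewrite mulmxDl -!scalemxAl mulmxBl -!scalemxAl cdotDr !cdotZr cdotBr !cdotZr.
rewrite rmorphM /=; ring.
Qed.

End Pencil.

Section Stability.
Local Open Scope complex_scope.
Variables (R : realType) (N s : nat) (A B : 'M[R]_N) (a b c : 'I_s.+1 -> R) (p : R).
Hypotheses (Asym : A^T = A) (Aneg : neg_definite A) (s_gt0 : (0 < s)%N).
Hypotheses (bs0 : b ord_max = 0) (as0 : a ord_max != 0) (cs0 : c ord_max != 0).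
Hypothesis solv : forall k : R, 0 < k ->
  (a ord_max)%:M - (k * c ord_max) *: A \in unitmx.
Hypothesis azero : zero_stable a.
Hypothesis WD : (Wset A B p `<=` Dregion a b c)%classic.
Let H := cplxmx (- A).
Let cpencil x j := cplxmx (pencil A B a b c x j).

(** A matrix is bounded below by its quadratic form for any bounded weight;
    the summand [1] keeps the constant positive for a zero weight. *)
Lemma symbol_bound : exists2 e : R[i], 0 < e &
  forall (x : R) v z, 0 <= x <= 1 -> 1 < `|z| <= 2 ->
    (`|z| - 1) * norm1 v <= e * norm1 (symbol (cpencil x) z v).
Proof.
have [e e0 He] := rangepoly_bound Asym Aneg s_gt0 bs0 as0 cs0 solv azero WD.
exists (e^-1 * (norm1 (mxpowR H (p - 1)) + 1)).
  by rewrite mulr_gt0 ?invr_gt0 // ltr_wpDl ?norm1_ge0.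
move=> x v z x01 /andP[z1 z2].
have z12 : 1 <= `|z| <= 2 by rewrite (ltW z1).
have [->|v0] := eqVneq v 0.
  by rewrite norm1_0 mulr0 !mulr_ge0 ?norm1_ge0 ?invr_ge0 ?(ltW e0) ?addr_ge0 ?norm1_ge0.
have nv0 : 0 < norm1 v.
  by rewrite lt_def norm1_ge0 andbT; apply: contraNneq v0 => n0; rewrite [v]norm1_eq0 // n0.
rewrite -(ler_pM2r nv0) -mulrA -expr2 -(ler_pM2l e0) [leLHS]mulrA.
apply: le_trans (He x v z x01 z12) _; rewrite -(cdot_symbol B a b c p Asym Aneg).
apply: le_trans (cdot_norm1 _ _) _; rewrite mulrC [leRHS]mulrA ler_wpM2r ?norm1_ge0 //.
apply: le_trans (norm1M _ _) _.
by rewrite !mulrA mulfV ?gt_eqF // mul1r ler_wpM2r ?norm1_ge0 // lerDl.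
Qed.

Lemma symbol_inj x z v : 0 < x < 1 -> 1 <= `|z| -> symbol (cpencil x) z v = 0 -> v = 0.
Proof.
move=> /andP[x0 x1] z1 sym0; apply/eqP/negPn/negP => v0.
have : `|z| < 1.
  apply: (rangepoly_root_lt1 Asym Aneg WD v0 (x := x)); first by rewrite (ltW x0).
  by rewrite /root -(cdot_symbol B a b c p Asym Aneg) sym0 mulmx0 /cdot mulmx0 mxE.
by rewrite real_ltNge ?real1 ?normr_real // z1.
Qed.

Lemma Wset_sub_Dregion_stable : unconditionally_stable A B a b c.
Proof.
have [e e0 He] := symbol_bound.
(* A bound on the coefficients of the recurrence that is uniform in [x]. *)
pose m : R[i] := (\sum_j (`|a j| * norm1 (1%:M : 'M[R]_N) + norm1 (c j *: A + b j *: B)))%:C.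
have m0 : 0 <= m.
  by rewrite lecR sumr_ge0 // => j _; rewrite addr_ge0 ?mulr_ge0 ?norm1_ge0.
pose K : R[i] := s%:R * (2 ^+ s * (e * (m * 2 ^+ s) + 1)).
have K0 : 0 <= K.
  by rewrite !(mulr_ge0, addr_ge0) ?exprn_ge0 ?ler0n ?ler01 // ltW.
have [kc kc0 Hkc] := kreiss_linear N s K0.
have kcE : kc = (complex.Re kc)%:C by rewrite RRe_real // ger0_real.
exists (complex.Re kc * (s%:R * N%:R)) => k u k0 sol n _.
set mu := \big[_/_]_(_ < _) _.
pose x := (1 + k)^-1.
have x01 : 0 < x < 1 by rewrite invr_gt0 addr_gt0 //= invf_lt1 ?ltrDl ?addr_gt0.
have x01' : 0 <= x <= 1 by case/andP: x01 => /ltW-> /ltW.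
have unitP : cpencil x ord_max \in unitmx.
  by rewrite map_unitmx pencil_unit.
pose w j := map_mx (real_complex R) (u j).
have rec j : recurrence (cpencil x) w j = 0.
  have /(congr1 (map_mx (real_complex R))) := scheme_recurrence j k0 sol.
  rewrite map_mx0 map_mx_sum => E; rewrite -[RHS]E.
  by apply: eq_bigr => l _; rewrite map_mxM.
have winE j : window s w j = iter j (companion (cpencil x)) (window s w 0).
  by elim: j => // j IHj; rewrite iterS -IHj companion_window.
have bound : norm1 (window s w n) <= kc * norm1 (window s w 0).
  rewrite winE; apply: Hkc => z U.
    move=> z12; apply: companion_resolvent => //; [|exact: ltW|by move=> v; apply: He].
    rewrite /cpencil (eq_bigr (fun j => (norm1 (pencil A B a b c x j))%:C)).
      by rewrite -rmorph_sum lecR norm1_pencil.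
    by move=> j _; apply: norm1_real.
  by move=> z1; apply: companion_spectrum => // v; apply: symbol_inj.
have first : (norm1 (u n))%:C <= norm1 (window s w n).
  rewrite -norm1_real [leRHS]norm1_col (bigD1 (Ordinal s_gt0)) //= col_window addn0 lerDl.
  by rewrite sumr_ge0 // => j _; rewrite norm1_ge0.
have init : norm1 (window s w 0) <= (s%:R * N%:R * mu)%:C.
  rewrite norm1_col (eq_bigr (fun j : 'I_s => (norm1 (u j))%:C)); last first.
    by move=> j _; rewrite col_window norm1_real.
  rewrite -rmorph_sum lecR -mulrA mulr_natl -[X in _ *+ X]card_ord -sumr_const.
  apply: ler_sum => j _; rewrite (le_trans (norm1_le_mul_enorm _)) // ler_wpM2l //.
  exact: le_bigmax.
apply: le_trans (enorm_le_norm1 _) _.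
rewrite -lecR -mulrA rmorphM /= -kcE (le_trans first) // (le_trans bound) // ler_wpM2l //.
Qed.

End Stability.

Theorem theorem3p4 (R : realType) (N s : nat) (A B : 'M[R]_N)
    (a b c : 'I_s.+1 -> R)
    (hAsym : A^T = A)
    (hAneg : neg_definite A)
    (hs : (1 <= s)%N)
    (hbs : b ord_max = 0)
    (has : a ord_max != 0)
    (hcs : c ord_max != 0)
    (hsolv : forall k : R, 0 < k ->
       (a ord_max)%:M - (k * c ord_max) *: A \in unitmx)
    (hzero : zero_stable a)
    (hW : exists p : R, (Wset A B p `<=` Dregion a b c)%classic) :
  unconditionally_stable A B a b c.
Proof.
have [p WD] := hW.
exact: (Wset_sub_Dregion_stable hAsym hAneg hs hbs has hcs hsolv hzero WD).
Qed.
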